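(* Let $\mathcal{D}=(\mathcal{P},\mathcal{B})$ be a $(v,k,\lambda)$ symmetric design with $k>\lambda(\lambda-2)$, and let $G$ be a flag-transitive automorphism group of $\mathcal{D}$. Then one of the following holds: (a) $G$ is point-primitive, and as a primitive permutation group on $\mathcal{P}$ it is of affine type or of almost simple type; (b) $G$ is point-imprimitive and $(v,k,\lambda)=(\lambda^2(\lambda+2),\lambda(\lambda+1),\lambda)$. Moreover, if $G$ preserves a system of imprimitivity on $\mathcal{P}$ consisting of $d$ classes of size $c$, then there is a constant $\ell$ such that $|B\cap\Delta|\in\{0,\ell\}$ for each block $B\in\mathcal{B}$ and each imprimitivity class $\Delta$, and $(c,d,\ell)=(\lambda^2,\lambda+2,\lambda)$ or $(c,d,\ell)=(\lambda+2,\lambda^2,2)$.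
   Context: A $2$-$(v,k,\lambda)$ design is a finite incidence structure $\mathcal{D}=(\mathcal{P},\mathcal{B})$ consisting of a set $\mathcal{P}$ of $v$ points and a set $\mathcal{B}$ of $k$-subsets of $\mathcal{P}$ (blocks) such that any two distinct points are contained in exactly $\lambda$ blocks; it is assumed that $2\le k<v$ and $\lambda\geq 1$. It is called a $(v,k,\lambda)$ symmetric design if the number of blocks equals $v$. An automorphism group $G$ of $\mathcal{D}$ is a permutation group on $\mathcal{P}$ preserving $\mathcal{B}$. It is flag-transitive if it acts transitively on the set of flags, i.e. pairs $(\alpha,B)$ with $\alpha\in\mathcal{P}$, $B\in\mathcal{B}$, $\alpha\in B$. It is point-primitive (point-imprimitive) if it acts primitively (imprimitively) on $\mathcal{P}$. A system of imprimitivity is a $G$-invariant partition of $\mathcal{P}$ into $d$ classes of equal size $c$ with $c,d>1$. A finite primitive permutation group $G$ is of affine type if it has an elementary abelian regular normal subgroup, and of almost simple type if its socle is a non-abelian simple group $T$ (so $T\le G\le \mathrm{Aut}(T)$). *)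

(* Defs.v *)
From mathcomp Require Import all_boot all_fingroup all_solvable.

Set Implicit Arguments.
Unset Strict Implicit.
Unset Printing Implicit Defensive.

Import GroupScope.

Section Designs.
Variables (P : finType) (blocks : {set {set P}}).

Definition is_2design (v k lam : nat) : Prop :=
  [/\ #|P| = v,
      forall B, B \in blocks -> #|B| = k,
      forall x y : P, x != y ->
        #|[set B in blocks | (x \in B) && (y \in B)]| = lam,
      (2 <= k < v)%N
    & (1 <= lam)%N].

Definition is_symmetric_design (v k lam : nat) : Prop :=
  is_2design v k lam /\ #|blocks| = v.

Variable G : {group {perm P}}.

Definition is_automorphism_group : Prop := [acts G, on blocks | 'P^*].

Definition is_flag (f : P * {set P}) : bool :=
  (f.2 \in blocks) && (f.1 \in f.2).

Definition flag_transitive : Prop :=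
  forall f f', is_flag f -> is_flag f' ->
    exists2 g, g \in G & f' = ('P%act f.1 g, 'P^*%act f.2 g).

End Designs.

Section PermutationGroups.
Variables (P : finType) (G : {group {perm P}}).

Definition point_primitive : Prop := [primitive G, on [set: P] | 'P].

Definition point_imprimitive : Prop :=
  [transitive G, on [set: P] | 'P] /\
  exists Q : {set {set P}}, imprimitivity_system G [set: P] 'P Q.

Definition regular_on_points (N : {group {perm P}}) : Prop :=
  [transitive N, on [set: P] | 'P] /\ forall x : P, 'C_N[x | 'P] = 1.

Definition affine_type : Prop :=
  exists N : {group {perm P}}, [/\ N <| G, is_abelem N & regular_on_points N].

End PermutationGroups.

(* [minnormal N G] only asks that G normalise N, hence the extra inclusion. *)
Definition socle (gT : finGroupType) (G : {group gT}) : {set gT} :=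
  << \bigcup_(N : {group gT} | (N \subset G) && minnormal N G) N >>.

Definition almost_simple_type (gT : finGroupType) (G : {group gT}) : Prop :=
  simple (socle G) /\ ~~ abelian (socle G).

(* Main.v *)
Require Import Defs.
From mathcomp Require Import all_boot all_fingroup all_solvable all_character.
From mathcomp Require Import zify.

Set Implicit Arguments.
Unset Strict Implicit.
Unset Printing Implicit Defensive.

(** Counting flags shows that [k] divides [lam * #|X|] for every [G_x]-invariant
    set [X] avoiding [x], so [q = k / gcd(k, lam)] divides [v - 1] and all
    subdegrees, while the bound on [k] gives [v < (q + 1)^3].

    If [G] is imprimitive, the same count applied to the class of [x] and to
    another class leaves only the two stated families.

    If [G] is primitive, neither affine nor almost simple, let [N] be a minimal
    normal subgroup. If every prime divisor of [#|N|]
    divides [v] (regular and diagonal types), a Sylow subgroup of [G_x] for a prime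
    dividing [q] acts coprimely on [N], which makes every [v`_r] congruent to 1
    modulo [q]; then [v], hence [#|N|], has at most two prime divisors and [N] is
    solvable by Burnside's theorem. Otherwise [G] preserves a product structure on
    the points, and the arithmetic leaves (v, k, lam) = (81, 16, 3), (121, 25, 5),
    (441, 56, 7), which are excluded by the way a block meets rows and columns. *)

(** * Symmetric designs *)

Section SymmetricDesign.

Variables (P : finType) (blocks : {set {set P}}) (v k lam : nat).
Hypothesis symD : is_symmetric_design blocks v k lam.

Let cardP : #|P| = v. Proof. by case: symD => -[]. Qed.
Let card_block B : B \in blocks -> #|B| = k.
Proof. by case: symD => -[_ + _ _ _] _; apply. Qed.
Let card_pair x y : x != y -> #|[set B in blocks | (x \in B) && (y \in B)]| = lam.
Proof. by case: symD => -[_ _ + _ _] _; apply. Qed.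
Let k_gt1 : 1 < k. Proof. by case: symD => -[_ _ _ /andP[]]. Qed.
Let k_lt_v : k < v. Proof. by case: symD => -[_ _ _ /andP[]]. Qed.
Let lam_gt0 : 0 < lam. Proof. by case: symD => -[]. Qed.

Definition blocks_at x := [set B in blocks | x \in B].

Lemma sum_card_blocks_setI (S : {set {set P}}) (X : {set P}) :
  \sum_(B in S) #|B :&: X| = \sum_(y in X) #|[set B in S | y \in B]|.
Proof.
have E1 B : #|B :&: X| = \sum_(y in X) (y \in B).
  rewrite -sum1_card big_mkcond /= [RHS]big_mkcond /=; apply: eq_bigr => y _.
  by rewrite inE andbC; case: (y \in X); case: (y \in B).
have E2 y : #|[set B in S | y \in B]| = \sum_(B in S) (y \in B).
  rewrite -sum1_card big_mkcond /= [RHS]big_mkcond /=; apply: eq_bigr => B _.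
  by rewrite inE; case: (B \in S); case: (y \in B).
rewrite (eq_bigr _ (fun B _ => E1 B)) exchange_big /=.
by rewrite (eq_bigr _ (fun y _ => E2 y)).
Qed.

Lemma sum_card_blocks_at x (X : {set P}) :
  x \notin X -> \sum_(B in blocks_at x) #|B :&: X| = lam * #|X|.
Proof.
move=> xX; rewrite sum_card_blocks_setI mulnC -sum_nat_const.
apply: eq_bigr => y yX.
have xy : x != y by apply: contraNneq xX => ->.
rewrite -(card_pair xy); apply: eq_card => B.
by rewrite !inE andbA.
Qed.

Lemma card_blocks_at_mul x : #|blocks_at x| * k.-1 = lam * v.-1.
Proof.
have <- : #|[set~ x]| = v.-1 by rewrite cardsC1 cardP.
rewrite -(@sum_card_blocks_at x) ?inE ?eqxx // -sum_nat_const.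
apply: eq_bigr => B; rewrite inE => /andP[Bb xB].
by rewrite -setDE -(card_block Bb) (cardsD1 x B) xB.
Qed.

(** By [card_blocks_at_mul] the number of blocks through a point does not depend on the point;
    counting all flags by blocks and by points equates it with [k], since there are [v] blocks. *)
Lemma card_blocks_at x : #|blocks_at x| = k.
Proof.
have r_const y : #|blocks_at y| = #|blocks_at x|.
  apply/eqP; rewrite -(@eqn_pmul2r k.-1); last by lia.
  by rewrite !card_blocks_at_mul.
have := sum_card_blocks_setI blocks [set: P].
rewrite (eq_bigr (fun _ => k)) => [|B Bb]; last by rewrite setIT card_block.
rewrite [RHS](eq_bigr (fun _ => #|blocks_at x|)) => [|y _]; last exact: r_const.
rewrite !sum_nat_const cardsT cardP (proj2 symD) => /eqP.
by rewrite eqn_pmul2l 1?eq_sym => [/eqP|]; lia.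
Qed.

Lemma symmetric_design_eq : k * k.-1 = lam * v.-1.
Proof.
have [x _] : exists x : P, true.
  have : 0 < #|P| by rewrite cardP; lia.
  by case/card_gt0P=> x _; exists x.
by rewrite -(card_blocks_at_mul x) card_blocks_at.
Qed.

Lemma lam_lt_k : lam < k.
Proof. by move: symmetric_design_eq k_gt1 k_lt_v lam_gt0; nia. Qed.

Lemma exists_block x : exists2 B, B \in blocks & x \in B.
Proof.
have : 0 < #|blocks_at x| by rewrite card_blocks_at; lia.
by case/card_gt0P=> B; rewrite inE => /andP[Bb xB]; exists B.
Qed.

Variable G : {group {perm P}}.
Hypothesis ftG : flag_transitive blocks G.

Lemma flag_transP x B y C : B \in blocks -> x \in B -> C \in blocks -> y \in C ->
  exists g : {perm P}, [/\ g \in G, y = g x & C = g @: B].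
Proof.
move=> Bb xB Cb yC.
have [] := @ftG (x, B) (y, C); rewrite /is_flag /= ?Bb ?Cb // => g Gg [-> ->].
exists g; split=> //; rewrite /= ?apermE //.
Qed.

Lemma flag_trans_points : [transitive G, on [set: P] | 'P].
Proof.
have /card_gt0P[x _] : 0 < #|P| by rewrite cardP; lia.
apply/imsetP; exists x => //; apply/setP=> y; rewrite inE; apply/esym/orbitP.
have [B Bb xB] := exists_block x; have [C Cb yC] := exists_block y.
have [g [Gg -> _]] := flag_transP Bb xB Cb yC.
by exists g.
Qed.

(* The blocks through [x] all meet a [G_x]-invariant set equally often. *)
Lemma flag_count x B (X : {set P}) : B \in blocks -> x \in B -> x \notin X ->
  (forall (g : {perm P}) y, g \in G -> g x = x -> y \in X -> g y \in X) ->
  lam * #|X| = k * #|B :&: X|.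
Proof.
move=> Bb xB xX invX; rewrite -(sum_card_blocks_at xX) -(card_blocks_at x).
rewrite -sum_nat_const; apply: eq_bigr => C; rewrite inE => /andP[Cb xC].
have [g [Gg gx ->]] := flag_transP Bb xB Cb xC.
have {1}<- : g @: X = X.
  apply/eqP; rewrite eqEcard card_imset ?leqnn ?andbT; last exact: perm_inj.
  by apply/subsetP=> _ /imsetP[y yX ->]; apply: invX.
rewrite -imsetI; last by move=> ? ? _ _; apply: perm_inj.
by rewrite card_imset //; apply: perm_inj.
Qed.

End SymmetricDesign.

(** * Imprimitive groups *)

(* With [h = l - 1] and [w = lam - h * z], the parameters are rational functions
   of [h], [z], [w], and the bound on [k] leaves [w = 1] and [h = 1] or [z = 1]
   up to the triples (2,2,1), (2,3,1), (3,2,1), which violate divisibility. *)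
Lemma imprimitive_arith_param h z w C D lam k :
  0 < h -> 0 < z -> 0 < w -> lam = h * z + w ->
  w * C = h * (h + 1 + z) -> C * z = h * D -> k = h.+1 + C.+1 * z ->
  w * k = (h + 1 + z) * lam -> lam * (lam - 2) < k ->
  h.+1 %| k -> h.+1 %| lam * C.+1 ->
  (h = 1 \/ z = 1) /\ w = 1.
Proof.
move=> h0 z0 w0 Dlam wC CD Dk wk ltk hk hlC.
have lt1 : w * (h * z + w - 2) < h + 1 + z.
  have : w * (lam * (lam - 2)) < (h + 1 + z) * lam by rewrite -wk ltn_pmul2l.
  by rewrite mulnCA mulnC ltn_mul2r -Dlam => /andP[].
have hhz : h <= h * z by rewrite leq_pmulr.
have zhz : z <= h * z by rewrite leq_pmull.
have w1 : w = 1.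
  have [//|w2|w3] : [\/ w = 1, w = 2 | 3 <= w].
    by case: w w0 {Dlam wC wk lt1} => [//|[|[|w]]] _; [apply: Or31|apply: Or32|apply: Or33].
  - subst w; have : h = 1 /\ z = 1 by clear -h0 z0 lt1 hhz zhz; nia.
    by case=> ? ?; subst; lia.
  - have : 3 * (h * z + 1) <= w * (h * z + w - 2) by apply: leq_mul; lia.
    clear -hhz zhz lt1 w3; lia.
subst w; split=> //.
have {}lt1 : h * z < h + z + 2 by lia.
have [->|h1] := eqVneq h 1; first by left.
have [->|z1] := eqVneq z 1; first by right.
have hb : h <= 4 by clear -h0 z0 h1 z1 lt1; nia.
have zb : z <= 4 by clear -h0 z0 h1 z1 lt1; nia.
move: h0 z0 h1 z1 lt1 hk hlC; rewrite Dk Dlam; move: wC; rewrite mul1n => ->.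
clear -hb zb.
by case: h hb => [|[|[|[|[|h]]]]] // _; case: z zb => [|[|[|[|[|z]]]]].
Qed.

(** Put [C = c - 1], [D = d - 1], [h = l - 1]. The product of the two counting equations, cleared of
    [k * lam], reads [C * (k - 1) = h * (c * d - 1)]. The differences [z = k - 1 - h * d] and
    [w = lam - h * z] then meet the hypotheses of [imprimitive_arith_param]; [z = 1] yields the
    first triple and [h = 1] the second. *)
Lemma imprimitive_arith c d l k lam :
  1 < c -> 1 < d -> 0 < lam -> 1 < k -> lam < k -> 0 < l ->
  lam * c.-1 = k * l.-1 -> k * k.-1 = lam * (c * d).-1 ->
  l %| k -> l %| lam * c -> lam * (lam - 2) < k ->
  [/\ c * d = lam ^ 2 * (lam + 2), k = lam * (lam + 1)
    & (c, d, l) = (lam ^ 2, lam + 2, lam) \/ (c, d, l) = (lam + 2, lam ^ 2, 2)].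
Proof.
case: c => [//|C] c1; case: d => [//|D] d1 lam0 k1 lamk.
case: l => [//|h] _; rewrite [C.+1.-1]/= [h.+1.-1]/= => lamC kk hk hlC ltk.
have h0 : 0 < h by case: h lamC {hk hlC} => [|//]; rewrite muln0 => /eqP; rewrite muln_eq0; lia.
have E1 : C * k.-1 = h * (C.+1 * D.+1).-1.
  apply/eqP; rewrite -(@eqn_pmul2l (k * lam)) ?muln_gt0 ?(ltnW k1) //.
  apply/eqP; transitivity ((lam * C) * (k * k.-1)); first by lia.
  by rewrite lamC kk; set V := (_ * _).-1; clearbody V; lia.
have ltlk : h.+1 < k.
  suff: h < k.-1 by lia.
  have : C.+1 * 2 <= C.+1 * D.+1 by rewrite leq_mul2l.
  rewrite -(@ltn_pmul2l C) ?E1 // [C * h]mulnC ltn_pmul2l //; lia.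
pose z := k.-1 - h * D.+1.
have Dk' : k.-1 = h * D.+1 + z.
  suff: h * D.+1 <= k.-1 by rewrite /z; lia.
  rewrite -(@leq_pmul2l C) // E1 mulnCA leq_pmul2l //; lia.
have E3 : k.-1 = h + C.+1 * z.
  move: E1; rewrite {1}Dk' mulnDr; have -> : (C.+1 * D.+1).-1 = C * D.+1 + D by lia.
  by move: Dk'; clearbody z; clear; lia.
have E2 : k = h.+1 + C.+1 * z by lia.
have z0 : 0 < z by case: (z) E2 => [|//]; lia.
have CD : C * z = h * D by move: E3; rewrite Dk' mulSn mulnS; lia.
have lehz : h * z <= lam.
  rewrite -(@leq_pmul2l C) // [C * lam]mulnC lamC E2 [_ * h]mulnC mulnCA.
  by rewrite leq_pmul2l // mulSn; lia.
pose w := lam - h * z; have Dlam : lam = h * z + w by rewrite /w; lia.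
have wC : w * C = h * (h + 1 + z).
  by move: lamC; rewrite E2 Dlam; clearbody w z; clear; lia.
have w0 : 0 < w by case: (w) wC => [|//] /esym/eqP; rewrite mul0n muln_eq0; lia.
have wk : w * k = (h + 1 + z) * lam.
  rewrite Dlam E2; transitivity (w * (h + 1 + z) + w * C * z).
    by clearbody w z; clear; lia.
  by rewrite wC; clearbody w z; clear; lia.
have [hz w1] := imprimitive_arith_param h0 z0 w0 Dlam wC CD E2 wk ltk hk hlC.
clear hk hlC.
rewrite w1 mul1n in wC; rewrite w1 in Dlam.
case: hz => [hh|hz].
- move: wC CD E2 Dlam; rewrite hh => wC CD E2 Dlam.
  have ED : D = C * z by lia.
  have EC : C = z.+2 by lia.
  have El : lam = z.+1 by lia.
  by rewrite E2 ED EC El -mulnn; clear; split; [lia|lia|right; congr (_, _, _); lia].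
- move: wC CD E2 Dlam; rewrite hz => wC CD E2 Dlam.
  have ED : D = h + 2.
    by apply/eqP; rewrite -(eqn_pmul2l h0) -CD muln1 wC; apply/eqP; lia.
  have EC : C = h * (h + 2) by lia.
  have El : lam = h.+1 by lia.
  by rewrite E2 ED EC El -mulnn; clear; split; [lia|lia|left; congr (_, _, _); lia].
Qed.

Section Imprimitive.

Variables (P : finType) (blocks : {set {set P}}) (v k lam : nat).
Variable G : {group {perm P}}.
Hypothesis symD : is_symmetric_design blocks v k lam.
Hypothesis ltk : lam * (lam - 2) < k.
Hypothesis ftG : flag_transitive blocks G.

(** An element of [G] that moves one flag to another also moves the class of its point, so every
    non-empty intersection has the size [l] found at [x0]. Applying [flag_count] to the class of
    [x0] without [x0] gives the equation linking [c] and [l]. *)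
Lemma imprimitive_parameters (Q : {set {set P}}) (c d : nat) :
  imprimitivity_system G [set: P] 'P Q -> #|Q| = d ->
  (forall Delta, Delta \in Q -> #|Delta| = c) ->
  [/\ v = lam ^ 2 * (lam + 2), k = lam * (lam + 1) &
    exists l : nat,
       (forall B Delta, B \in blocks -> Delta \in Q ->
          #|B :&: Delta| = 0 \/ #|B :&: Delta| = l) /\
       ((c, d, l) = (lam ^ 2, lam + 2, lam) \/
        (c, d, l) = (lam + 2, lam ^ 2, 2))].
Proof.
case/and3P=> partQ actQ /andP[d1 dv] cardQ card_class.
have [[cardP card_block _ /andP[k1 kv] lam0] _] := symD.
have [coverQ trivQ _] := and3P partQ.
have Dv : v = c * d.
  rewrite -cardP -cardsT (card_uniform_partition card_class partQ) cardQ.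
  by rewrite mulnC.
have c1 : 1 < c.
  by move: dv; rewrite cardsT cardP Dv cardQ; case: c {card_class Dv} => [|[]]; lia.
have inQ x : exists2 D, D \in Q & x \in D.
  have : x \in cover Q by rewrite (eqP coverQ) inE.
  by case/bigcupP=> D; exists D.
have uniqQ x D E : D \in Q -> E \in Q -> x \in D -> x \in E -> D = E.
  move=> QD QE xD xE; apply/eqP/contraT => DE.
  have := trivIsetP trivQ _ _ QD QE DE.
  by rewrite -setI_eq0 => /eqP/setP/(_ x); rewrite !inE xD xE.
have actQ' g D : g \in G -> D \in Q -> g @: D \in Q.
  by move=> Gg QD; have := actsP actQ _ Gg D; rewrite QD.
have [B0 B0b [x0 x0B]] : exists2 B, B \in blocks & exists x, x \in B.
  have /card_gt0P[x _] : 0 < #|P| by rewrite cardP; lia.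
  by have [B Bb xB] := exists_block symD x; exists B => //; exists x.
have [D0 QD0 x0D] := inQ x0.
pose l := #|B0 :&: D0|.
have constl B D x : B \in blocks -> D \in Q -> x \in B -> x \in D -> #|B :&: D| = l.
  move=> Bb QD xB xD; have [g [Gg gx gB]] := flag_transP ftG B0b x0B Bb xB.
  have -> : D = g @: D0.
    by apply: (uniqQ x) => //; rewrite ?actQ' // gx imset_f.
  rewrite gB -imsetI; last by move=> ? ? _ _; apply: perm_inj.
  by rewrite card_imset //; apply: perm_inj.
have dichot B D : B \in blocks -> D \in Q -> #|B :&: D| = 0 \/ #|B :&: D| = l.
  move=> Bb QD; case: (set_0Vmem (B :&: D)) => [->|[x]]; first by left; rewrite cards0.
  by rewrite inE => /andP[xB xD]; right; apply: constl xB xD.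
have l0 : 0 < l by apply/card_gt0P; exists x0; rewrite inE x0B.
have eq1 : lam * c.-1 = k * l.-1.
  have invD (g : {perm P}) y : g \in G -> g x0 = x0 -> y \in D0 :\ x0 -> g y \in D0 :\ x0.
    move=> Gg gx; rewrite !inE -{2}gx (inj_eq perm_inj) => /andP[-> yD].
    have <- : g @: D0 = D0 by apply: (uniqQ x0); rewrite ?actQ' // -gx imset_f.
    exact: imset_f.
  have := flag_count symD ftG B0b x0B _ invD; rewrite !inE eqxx => /(_ isT).
  have := cardsD1 x0 D0; rewrite x0D card_class // => ->.
  by have := cardsD1 x0 (B0 :&: D0); rewrite inE x0B x0D -/l setIDA => ->.
have eq2 : k * k.-1 = lam * (c * d).-1 by rewrite -Dv (symmetric_design_eq symD).
have lk : l %| k.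
  rewrite -(card_block _ B0b) -[B0]setIT -(eqP coverQ).
  have -> : #|B0 :&: cover Q| = \sum_(D in Q) #|B0 :&: D|.
    rewrite -[RHS](eq_bigr _ (fun D _ => cardsE _)).
    transitivity (\sum_(x in cover Q) (x \in B0)).
      rewrite -sum1_card big_mkcond [RHS]big_mkcond /=.
      by apply: eq_bigr => x _; rewrite inE andbC; case: (x \in cover Q); case: (x \in B0).
    rewrite big_trivIset //=; apply: eq_bigr => D _.
    rewrite cardsE -sum1_card big_mkcond [RHS]big_mkcond /=.
    by apply: eq_bigr => x _; rewrite inE andbC; case: (x \in D); case: (x \in B0).
  by apply: dvdn_sum => D QD; have [->|->] := dichot B0 D B0b QD.
have [D1 QD1 D1x] : exists2 D, D \in Q & x0 \notin D.
  have /card_gt0P[D] : 0 < #|Q :\ D0| by move: d1; rewrite (cardsD1 D0 Q) QD0.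
  rewrite !inE => /andP[DD0 QD]; exists D => //.
  by apply: contraNN DD0 => xD; apply/eqP; apply: (uniqQ x0).
(* Each block through [x0] meets the other class [D1] in [0] or [l] points, and these intersections
   add up to [lam * c]. *)
have llc : l %| lam * c.
  rewrite -(card_class _ QD1) -(sum_card_blocks_at symD D1x).
  apply: dvdn_sum => B; rewrite inE => /andP[Bb _].
  by have [->|->] := dichot B D1 Bb QD1.
rewrite cardQ in d1.
have [E1 E2 E3] := imprimitive_arith c1 d1 lam0 k1 (lam_lt_k symD) l0 eq1 eq2 lk llc ltk.
by split=> //; [rewrite Dv | exists l].
Qed.

(* Classes of an arbitrary imprimitivity system have equal size by transitivity. *)
Lemma imprimitivity_system_vk (Q : {set {set P}}) :
  imprimitivity_system G [set: P] 'P Q ->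
  v = lam ^ 2 * (lam + 2) /\ k = lam * (lam + 1).
Proof.
move=> impQ; have [partQ actQ _] := and3P impQ.
have [coverQ trivQ Q0] := and3P partQ.
suff [c cc] : exists c, forall D, D \in Q -> #|D| = c.
  by have [] := imprimitive_parameters impQ erefl cc.
have [->|[D0 QD0]] := set_0Vmem Q; first by exists 0 => D; rewrite inE.
exists #|D0| => D QD.
have [x xD] : exists x, x \in D by apply/set0Pn; apply: contraNneq Q0 => <-.
have [y yD] : exists x, x \in D0 by apply/set0Pn; apply: contraNneq Q0 => <-.
have [g Gg gy] := atransP2 (flag_trans_points symD ftG) (in_setT y) (in_setT x).
have QgD : 'P^*%act D0 g \in Q by rewrite (actsP actQ).
have -> : D = 'P^*%act D0 g.
  apply/eqP/contraT => /(trivIsetP trivQ _ _ QD QgD).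
  rewrite -setI_eq0 => /eqP/setP/(_ x); rewrite !inE xD gy.
  by rewrite mem_setact.
by rewrite card_setact.
Qed.

End Imprimitive.

(** * Primitive permutation groups *)

Section GroupLemmas.

Local Open Scope group_scope.

Lemma faithful_dvdn_fact (gT : finGroupType) (rT : finType) (A : {group gT})
    (to : {action gT &-> rT}) (S : {set rT}) :
  [acts A, on S | to] -> [faithful A, on S | to] -> #|A| %| #|S|`!.
Proof.
move=> nSA faithA; have /isom_card -> := faithful_isom nSA faithA.
rewrite -perm.card_Sym; apply: cardSg; apply/subsetP=> _ /morphimP[a _ Aa ->].
rewrite inE; apply/subsetP=> x; apply: contraR => Sx.
by rewrite permE /= /actby (negPf Sx) eqxx.
Qed.

Lemma simple_minnormal_self (gT : finGroupType) (N : {group gT}) :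
  minnormal N N -> simple N.
Proof.
case/mingroupP=> /andP[ntN _] minN; apply/simpleP; split=> // H /andP[sHN nHN].
have [/eqP|ntH] := boolP (H :==: 1); [by left | right].
by rewrite (minN H) // ntH.
Qed.

Lemma minnormal_abelian (gT : finGroupType) (N G : {group gT}) :
  minnormal N G -> solvable N -> abelian N.
Proof. by move=> minN solN; have [_ _ /abelem_abelian] := minnormal_solvable minN (subxx N) solN. Qed.

Lemma minnormal_eq1_or (gT : finGroupType) (N G H : {group gT}) :
  minnormal N G -> H \subset N -> G \subset 'N(H) -> H :=: 1 \/ H :=: N.
Proof.
case/mingroupP=> _ minN sHN nHG.
have [/eqP|ntH] := boolP (H :==: 1); [by left | right].
by rewrite (minN H) // ntH.
Qed.

Section Permutations.

Variables (P : finType) (G : {group {perm P}}).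

(** If [h] in [M] takes [x] to [y], then [g y = g (h x) = h (g x) = h x = y]. *)
Lemma trans_cent_fix (M : {group {perm P}}) g x :
  [transitive M, on [set: P] | 'P] -> g \in 'C(M) -> g x = x -> g = 1.
Proof.
move=> trM cMg gx; apply/permP=> y; rewrite perm1.
have [h Mh ->] := atransP2 trM (in_setT x) (in_setT y).
by rewrite /= apermE -permM -(centP cMg h Mh) permM gx.
Qed.

(** If [h] in [N] takes [x] to [y], then [a ^ h^-1] lies in [A] and fixes [x], so [a] fixes [y]. *)
Lemma trans_normal_fix (N A : {group {perm P}}) x :
  [transitive N, on [set: P] | 'P] -> N \subset 'N(A) ->
  (forall a : {perm P}, a \in A -> a x = x) -> A :=: 1.
Proof.
move=> trN nAN Ax; apply/trivgP/subsetP=> a Aa; rewrite inE; apply/eqP/permP=> y.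
have [h Nh ->] := atransP2 trN (in_setT x) (in_setT y).
rewrite perm1 /= apermE.
have /Ax Aah : a ^ h^-1 \in A by rewrite memJ_norm // groupV (subsetP nAN).
by move: Aah; rewrite conjgE invgK !permM => {2}<-; rewrite permKV.
Qed.

Lemma semiregular_dvdn (A : {group {perm P}}) :
  (forall x, 'C_A[x | 'P] = 1) -> #|A| %| #|P|.
Proof.
move=> regA; rewrite -cardsT.
have actA : [acts A, on [set: P] | 'P].
  by apply/actsP=> a _ x; rewrite !inE.
rewrite -(acts_sum_card_orbit actA); apply: dvdn_sum => _ /imsetP[x _ ->].
by rewrite -(card_orbit_stab 'P A x) regA cards1 muln1.
Qed.

Hypothesis primG : point_primitive G.

(** The [g] in [G] with [R x (g x)] are closed under products, hence form a subgroup of the finite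
    group [G]. It contains the stabiliser of [x], which is maximal by primitivity, so it is the
    stabiliser or [G]; these are the two outcomes. *)
Lemma primitive_invariant_preorder (R : rel P) x :
  reflexive R -> transitive R ->
  (forall (g : {perm P}) y z, g \in G -> R y z -> R (g y) (g z)) ->
  (forall y, R x y -> x = y) \/ (forall y, R x y).
Proof.
move=> Rr Rt Rinv; have trG : [transitive G, on [set: P] | 'P] by case/andP: primG.
have gH : group_set [set g in G | R x (g x)].
  apply/group_setP; split; first by rewrite inE group1 perm1 Rr.
  move=> g h; rewrite !inE => /andP[Gg Rg] /andP[Gh Rh]; rewrite groupM //= permM.
  by apply: Rt Rh _; apply: Rinv.
pose H := Group gH.
have := primG; rewrite /point_primitive (trans_prim_astab (in_setT x) trG).
case/maximal_eqP=> _ /(_ H) [||eqH|eqH].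
- apply/subsetP=> g /setIP[Gg /astab1P gx]; rewrite inE Gg /=.
  by have -> : g x = x by exact: gx.
- by apply/subsetP=> g; rewrite inE => /andP[].
- left=> y Rxy; have [g Gg Dy] := atransP2 trG (in_setT x) (in_setT y).
  have : g \in H by rewrite inE Gg; rewrite Dy in Rxy.
  rewrite -[g \in H]/(g \in gval H) eqH => /setIP[_ /astab1P gx].
  by rewrite Dy gx.
- right=> y; have [g Gg Dy] := atransP2 trG (in_setT x) (in_setT y).
  have : g \in gval H by rewrite eqH.
  by rewrite inE Gg /= Dy.
Qed.

Lemma primitive_minnormal_trans (N : {group {perm P}}) :
  N \subset G -> minnormal N G -> [transitive N, on [set: P] | 'P].
Proof.
move=> sNG minN; have [/andP[ntN nNG] _] := mingroupP minN.
case: (prim_trans_norm primG (_ : N <| G)) => [|fixN|//]; first by rewrite /normal sNG.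
have := perm_faithful G; rewrite /faithful => faithG.
by case/negP: ntN; rewrite -subG1 (subset_trans fixN).
Qed.

End Permutations.

End GroupLemmas.

(* [cl i x] plays the role of the [i]-th coordinate of the point [x]. *)
Definition invariant_grid (P I : finType) (G : {group {perm P}})
    (cl : I -> P -> {set P}) (w : nat) : Prop :=
  [/\ forall x y, (forall i, cl i x = cl i y) -> x = y,
      forall i x y, exists2 z, cl i z = cl i y & forall j, j != i -> cl j z = cl j x,
      forall i, #|[set cl i x | x : P]| = w
    & forall g : {perm P}, g \in G -> exists2 s : I -> I, injective s &
        forall i x y, (cl (s i) (g x) == cl (s i) (g y)) = (cl i x == cl i y)].

(** * Conjugates in [G] of a minimal normal subgroup [T] of [N] *)

Section MinimalNormal.

Local Open Scope group_scope.

Variables (P : finType) (G N T : {group {perm P}}).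
Hypotheses (primG : point_primitive G) (sNG : N \subset G) (minN : minnormal N G).
Hypothesis nabN : ~~ abelian N.
Hypotheses (minT : minnormal T N) (sTN : T \subset N).

Let nNG : G \subset 'N(N). Proof. by have [/andP[]] := mingroupP minN. Qed.
Let trN : [transitive N, on [set: P] | 'P].
Proof. exact: (primitive_minnormal_trans primG sNG minN). Qed.
Let ntT : T :!=: 1. Proof. by have [/andP[]] := mingroupP minT. Qed.
Let nTN : N \subset 'N(T). Proof. by have [/andP[]] := mingroupP minT. Qed.
Let TT : gval T \in T :^: G. Proof. by apply/imsetP; exists 1; rewrite ?group1 ?conjsg1. Qed.

Let Tconj g : g \in G -> T :^ g \in T :^: G. Proof. exact: imset_f. Qed.

Lemma conj_minnormal_factor (A : {group {perm P}}) : gval A \in T :^: G ->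
  [/\ A \subset N, N \subset 'N(A), #|A| = #|T| &
      forall H : {group {perm P}}, H \subset A -> N \subset 'N(H) -> H :=: 1 \/ H :=: A].
Proof.
case/imsetP=> g Gg ->; have nNg : N :^ g = N by rewrite (normsP nNG).
split; [by rewrite -nNg conjSg | by rewrite -nNg normJ conjSg | by rewrite cardJg |].
move=> H sHA nHN.
have sHT : (H :^ g^-1)%G \subset T by rewrite sub_conjgV.
have nHN' : N \subset 'N((H :^ g^-1)%G).
  by rewrite /= normJ -sub_conjg nNg.
have [E|E] := minnormal_eq1_or minT sHT nHN'.
  by left; rewrite -(conjsgKV g H) E conjs1g.
by right; rewrite -(conjsgKV g H) E.
Qed.

(** By minimality [A :&: B] is trivial or [A]; the latter forces [A = B] by cardinality. Subgroups
    that normalise each other and meet trivially commute. *)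
Lemma conj_minnormal_cent (A B : {group {perm P}}) :
  gval A \in T :^: G -> gval B \in T :^: G -> A :!=: B -> A \subset 'C(B).
Proof.
move=> TA TB AB; have [sAN nAN cA mA] := conj_minnormal_factor TA.
have [sBN nBN cB mB] := conj_minnormal_factor TB.
have [E|E] := mA (A :&: B)%G (subsetIl A B) (normsI nAN nBN).
  apply/commG1P/trivgP; rewrite -E subsetI commg_subl commg_subr.
  by rewrite (subset_trans sBN) ?(subset_trans sAN).
case/negP: AB; rewrite eqEcard cA cB leqnn andbT.
by rewrite -E subsetIr.
Qed.

Lemma conj_minnormal_gen : <<class_support T G>> = N.
Proof.
have [_ minN'] := mingroupP minN.
have sub : <<class_support T G>> \subset N by rewrite gen_subG class_support_sub_norm.
rewrite -[LHS]/(gval <<class_support T G>>%G) (minN' <<class_support T G>>%G) //.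
rewrite norms_gen ?class_support_norm // andbT.
apply: contraNneq ntT => E; rewrite -subG1 -E.
by apply: subset_trans (subset_gen _); rewrite class_supportEr -{1}(conjsg1 T) (bigcup_sup 1).
Qed.

(** The conjugates of [T] generate [N], and all of them except [A] centralise [A]. *)
Lemma conj_minnormal_mul (A : {group {perm P}}) : gval A \in T :^: G ->
  A * 'C_N(A) = N.
Proof.
move=> TA; have [sAN nAN cA mA] := conj_minnormal_factor TA.
apply/eqP; rewrite eqEsubset mul_subG ?subsetIl //=.
rewrite -(norm_joinEr (_ : _ \subset 'N(A))); last first.
  by apply: subset_trans nAN; apply: subsetIl.
rewrite -{1}conj_minnormal_gen gen_subG class_supportEr; apply/bigcupsP=> g Gg.
have TB : gval (T :^ g)%G \in T :^: G by apply: Tconj.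
have [->|AB] := eqVneq (T :^ g) A; first exact: joing_subl.
apply: subset_trans (joing_subr _ _); rewrite subsetI.
have [-> _ _ _] := conj_minnormal_factor TB.
exact: (@conj_minnormal_cent (T :^ g)%G A).
Qed.

Lemma conj_minnormal_pgroup (pi : nat_pred) : pi.-group T -> pi.-group N.
Proof.
move=> piT; suff: N \subset 'O_pi(N) by move/pgroupS; apply; apply: pcore_pgroup.
rewrite -{1}conj_minnormal_gen gen_subG class_supportEr; apply/bigcupsP=> g Gg.
have TB : gval (T :^ g)%G \in T :^: G by apply: Tconj.
have [sBN nBN _ _] := conj_minnormal_factor TB.
by apply: (@pcore_max _ _ _ (T :^ g)%G); rewrite ?pgroupJ // /normal sBN.
Qed.

(** A solvable [T] would be abelian by minimality, and [N] would be generated by abelian conjugates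
    that commute with each other. *)
Lemma minnormal_factor_nonsolvable : ~~ solvable T.
Proof.
apply: contra nabN => /(minnormal_abelian minT) abT.
rewrite -conj_minnormal_gen abelian_gen /abelian class_supportEr.
apply/bigcupsP=> g Gg; rewrite centsC; apply/bigcupsP=> h Gh.
have [->|AB] := eqVneq (T :^ h) (T :^ g); first by move: abT; rewrite -(abelianJ T g).
apply: (@conj_minnormal_cent (T :^ h)%G (T :^ g)%G) => //; exact: Tconj.
Qed.

(** Here [N] is the product of its stabiliser of [x] with ['C_N(T)], and both factors normalise
    ['C_T[x | 'P]]. By minimality this is [1] or [T], and [T] cannot fix a point. So [T] is
    semiregular, [#|T|] divides [#|P|], and the primes of [N] are those of [T]. *)
Lemma trans_cent_factor_primes : [transitive 'C_N(T), on [set: P] | 'P] ->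
  {subset \pi(#|N|) <= \pi(#|P|)}.
Proof.
move=> trC.
have regT x : 'C_T[x | 'P] = 1.
  have nC : N \subset 'N('C_T[x | 'P]).
    have <- : 'C_N[x | 'P] * 'C_N(T) = N.
      exact/(subgroup_transitiveP (in_setT x) (subsetIl N 'C(T)) trN).
    rewrite mulG_subG; apply/andP; split.
      apply: normsI; first by apply: subset_trans nTN; apply: subsetIl.
      by apply: subset_trans (normG _); apply: subsetIr.
    apply: cents_norm; rewrite centsC; apply: subset_trans (subsetIl _ _) _.
    by rewrite centsC subsetIr.
  have [//|E] := minnormal_eq1_or minT (subsetIl T 'C[x | 'P]) nC.
  have fixx a : a \in T -> a x = x by rewrite -E => /setIP[_ /astab1P].
  by case/eqP: ntT; apply: trans_normal_fix trN nTN fixx.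
have dvdT := semiregular_dvdn regT.
have P0 : 0 < #|P|.
  have /card_gt0P[x _] : 0 < #|[set: P]| by case/imsetP: trN => x _ ->; apply/card_gt0P; exists x; apply: orbit_refl.
  by apply/card_gt0P; exists x.
have : \pi(#|P|).-group T by apply: pnat_dvd dvdT _; rewrite pnat_pi.
by move/conj_minnormal_pgroup=> /pgroupP pN p; rewrite !mem_primes cardG_gt0 => /and3P[pr _ /(pN _ pr)]; rewrite mem_primes.
Qed.

Hypothesis nsimN : ~~ simple N.

Definition conj_factor := {A : {set {perm P}} | A \in T :^: G}.

(** The centraliser of the factor [i] contains all other factors, so moving [x] by another factor
    keeps its class for [i]: the class acts as the [i]-th coordinate of [x]. *)
Definition factor_class (i : conj_factor) (x : P) : {set P} := orbit 'P 'C_N(val i) x.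

(** If [T] were its only conjugate, it would be normalised by [G], hence equal to [N]; then [N]
    would be minimal normal in itself, so simple. *)
Lemma conj_factor_gt1 : 1 < #|{: conj_factor}|.
Proof.
rewrite card_sig; apply: contraR nsimN; rewrite -leqNgt => /card_le1_eqP le1.
suff DT : T = N by apply: simple_minnormal_self; rewrite -{1}DT.
have [_ minN1] := mingroupP minN; apply: val_inj; apply: (minN1 T) => //.
rewrite ntT; apply/subsetP=> g Gg; rewrite inE.
have Tg : T :^ g \in T :^: G by apply: Tconj.
by rewrite -(le1 _ _ Tg TT).
Qed.

Lemma conj_cent_factor (A : {set {perm P}}) g : g \in G -> 'C_N(A) :^ g = 'C_N(A :^ g).
Proof. by move=> Gg; rewrite conjIg centJ (normsP nNG). Qed.

Lemma factor_class_act (A : {set {perm P}}) (g : {perm P}) x : g \in G ->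
  orbit 'P 'C_N(A :^ g) (g x) = g @: orbit 'P 'C_N(A) x.
Proof.
move=> Gg; apply/setP=> y; rewrite -conj_cent_factor // -[y](permKV g).
by rewrite mem_imset; [exact: (orbit_conjsg 'P) | exact: perm_inj].
Qed.

(** The default [i] of [insubd] can be reached only for [g] outside [G]. *)
Definition conj_factor_act (g : {perm P}) (i : conj_factor) : conj_factor :=
  insubd i (val i :^ g).

Lemma val_conj_factor_act g i : g \in G -> val (conj_factor_act g i) = val i :^ g.
Proof.
move=> Gg; rewrite val_insubd; case/imsetP: (valP i) => h Gh ->.
by rewrite -conjsgM Tconj // groupM.
Qed.

Lemma conj_factor_group (i : conj_factor) : exists2 A : {group {perm P}},
  val i = A & gval A \in T :^: G.
Proof.
by case/imsetP: (valP i) => g Gg E; exists (T :^ g)%G => //=; apply: Tconj.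
Qed.

(** Lying in all classes of a point is a [G]-invariant preorder. By primitivity it is equality,
    since otherwise a single class for [T] would contain every point. Elements of [G] permute the
    coordinates by conjugating the factors. *)
Lemma factor_class_invariant_grid :
  ~~ [transitive 'C_N(T), on [set: P] | 'P] ->
  invariant_grid G factor_class #|[set orbit 'P 'C_N(T) x | x : P]|.
Proof.
move=> ntrC; split.
- move=> x y eqxy.
  pose R (y z : P) := [forall i : conj_factor, z \in factor_class i y].
  case: (@primitive_invariant_preorder _ G primG R x).
  + by move=> z; apply/forallP=> i; apply: orbit_refl.
  + move=> b a c /forallP Rab /forallP Rbc; apply/forallP=> i.
    exact: orbit_trans (Rbc i) (Rab i).
  + move=> g a b Gg /forallP Rab; apply/forallP=> i.
    have := Rab (conj_factor_act g^-1 i); rewrite /factor_class.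
    rewrite val_conj_factor_act ?groupV // => H.
    rewrite -[val i](conjsgKV g) factor_class_act //; exact: imset_f.
  + by apply; apply/forallP=> i; rewrite eqxy; apply: orbit_refl.
  + move=> Rx; case/negP: ntrC; apply/imsetP; exists x => //.
    apply/setP=> z; rewrite inE; apply/esym.
    exact: (forallP (Rx z) (Sub (gval T) TT)).
- move=> i x y; have [A Di TA] := conj_factor_group i.
  have [n Nn Dy] := atransP2 trN (in_setT x) (in_setT y).
  (* The point [y] is reached from [x] by [a] in [A] followed by [c] centralising [A]: [a] alters no
     coordinate other than [i], and [c] preserves the class for [i]. *)
  have : n \in A * 'C_N(A) by rewrite conj_minnormal_mul.
  case/mulsgP=> a c Aa Cc Dn.
  exists (a x) => [|j ji].
    rewrite /factor_class Di; apply/esym/orbit_eqP.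
    by apply/orbitP; exists c => //; rewrite Dy Dn /= !apermE permM.
  have [B Dj TB] := conj_factor_group j.
  rewrite /factor_class Dj; apply/orbit_eqP/orbitP; exists a => //.
  have [sAN _ _ _] := conj_minnormal_factor TA.
  rewrite inE (subsetP sAN) //; apply: (subsetP (conj_minnormal_cent TA TB _)) => //.
  by rewrite -Di -Dj eq_sym.
- move=> i; have /imsetP[g Gg Di] := valP i.
  have -> : [set factor_class i x | x : P]
          = (fun X : {set P} => g @: X) @: [set orbit 'P 'C_N(T) x | x : P].
    apply/setP=> X; apply/imsetP/imsetP=> [[x _ ->]|[_ /imsetP[x _ ->] ->]].
      exists (orbit 'P 'C_N(T) (g^-1 x)); first exact: imset_f.
      by rewrite -factor_class_act // permKV -Di.
    by exists (g x) => //; rewrite -factor_class_act // -Di.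
  by rewrite card_imset //; apply: imset_inj; apply: perm_inj.
- move=> g Gg; exists (conj_factor_act g).
    move=> i j /(congr1 val); rewrite !val_conj_factor_act // => /conjsg_inj.
    exact: val_inj.
  move=> i x y; rewrite /factor_class val_conj_factor_act // !factor_class_act //.
  by rewrite (inj_eq (imset_inj (@perm_inj _ g))).
Qed.

(** The kernel of [T] on the classes is normalised by [N], so it is [1] or [T]. If it is [T], then
    [N = T * 'C_N(T)] fixes a class, and ['C_N(T)] is transitive. If it is [1] and there are at most
    four classes, then [#|T|] divides [4!] and [T] is solvable. *)
Lemma factor_class_gt4 : ~~ [transitive 'C_N(T), on [set: P] | 'P] ->
  4 < #|[set orbit 'P 'C_N(T) x | x : P]|.
Proof.
set O := [set _ | _ in _] => ntrC; rewrite ltnNge.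
apply: contra minnormal_factor_nonsolvable => O4.
have actO : [acts N, on O | 'P^*].
  apply/subsetP=> g Ng; rewrite !inE; apply/subsetP=> _ /imsetP[x _ ->].
  rewrite inE; apply/imsetP; exists (g x) => //.
  have Gg : g \in G by rewrite (subsetP sNG).
  by rewrite -{2}(normP (subsetP nTN _ Ng)) factor_class_act.
have nH : N \subset 'N(T :&: 'C(O | 'P^*)).
  apply: normsI => //; apply: subset_trans (astab_norm _ _).
  exact: actO.
have fixO : T :&: 'C(O | 'P^*) = 1.
  have [//|E] := minnormal_eq1_or minT (subsetIl T 'C(O | 'P^*)) nH.
  case/negP: ntrC; have [x _ _] := imsetP trN; apply/imsetP; exists x => //.
  apply/setP=> y; rewrite inE; apply/esym.
  have [n Nn ->] := atransP2 trN (in_setT x) (in_setT y).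
  have : n \in T * 'C_N(T) by rewrite conj_minnormal_mul.
  case/mulsgP=> a c Ta Cc ->; rewrite actM.
  have /setIP[_ /astabP fixa] : a \in ('C_T(O | 'P^*))%G by rewrite /= E.
  have xO : orbit 'P 'C_N(T) x \in O by apply: imset_f.
  have := mem_setact 'P a (orbit_refl 'P 'C_N(T)%G x); rewrite (fixa _ xO).
  by apply: orbit_trans; apply: mem_orbit.
have := @faithful_dvdn_fact _ _ T ('P^*)%act O (subset_trans sTN actO).
rewrite /faithful fixO subxx => /(_ isT) dvdT.
apply: Burnside_p_a_q_b; have : {subset primes #|T| <= primes 4`!}.
  move=> p; rewrite !mem_primes => /and3P[-> _ pT] /=.
  apply: dvdn_trans pT (dvdn_trans dvdT _).
  by move: #|O| O4; do 5?[case=> //].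
by move/(uniq_leq_size (primes_uniq _)).
Qed.

End MinimalNormal.

(** * A weak O'Nan-Scott theorem *)

Section PrimitiveStructure.

Local Open Scope group_scope.

(** A minimal normal subgroup not contained in [N] meets [N] trivially, hence centralises it and is
    trivial. *)
Lemma socle_unique_minnormal (gT : finGroupType) (G N : {group gT}) :
  N \subset G -> minnormal N G -> 'C_G(N) = 1 -> socle G = N.
Proof.
move=> sNG minN CN1; have [/andP[ntN nNG] minN'] := mingroupP minN.
apply/eqP; rewrite /socle eqEsubset gen_subG; apply/andP; split; last first.
  by apply: subset_trans (subset_gen _); apply: (bigcup_sup N) => //; rewrite sNG.
apply/bigcupsP=> M /andP[sMG minM]; have [/andP[ntM nMG] _] := mingroupP minM.
have [E|E] := minnormal_eq1_or minM (subsetIl M N) (normsI nMG nNG); last first.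
  by rewrite -E subsetIr.
case/eqP: ntM; apply/trivgP; rewrite -CN1 subsetI sMG.
apply/commG1P/trivgP; rewrite -E subsetI commg_subl commg_subr.
by rewrite (subset_trans sNG) ?(subset_trans sMG).
Qed.

(* A weak form of the O'Nan-Scott theorem. The third case covers non-abelian
   regular normal subgroups and groups of diagonal type, the last one product
   actions. *)
Theorem primitive_structure (P : finType) (G : {group {perm P}}) :
  1 < #|P| -> point_primitive G ->
  [\/ affine_type G, almost_simple_type G,
      exists N : {group {perm P}}, [/\ N <| G, [transitive N, on [set: P] | 'P],
        {subset \pi(#|N|) <= \pi(#|P|)} & ~~ solvable N]
    | exists (I : finType) (cl : I -> P -> {set P}) (w : nat),
        [/\ 1 < #|I|, 4 < w & invariant_grid G cl w]].
Proof.
move=> P1 primG; have trG : [transitive G, on [set: P] | 'P] by case/andP: primG.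
have ntG : G :!=: 1.
  apply: contraTneq P1 => G1; case/imsetP: trG => x _.
  rewrite -leqNgt -cardsT => ->; rewrite /orbit G1.
  by rewrite imset_set1 cards1.
have [N minN sNG] := minnormal_exists ntG (normG G).
have [/andP[ntN nNG] minN'] := mingroupP minN.
have trN := primitive_minnormal_trans primG sNG minN.
have nsNG : N <| G by rewrite /normal sNG.
have [abN|nabN] := boolP (abelian N).
  constructor 1; exists N; split=> //.
    by have [_ _] := minnormal_solvable minN (subxx N) (abelian_sol abN).
  split=> // x; apply/trivgP/subsetP=> g /setIP[Ng /astab1P gx].
  by rewrite inE; apply/eqP; apply: trans_cent_fix trN _ gx; apply: (subsetP abN).
have nsolN : ~~ solvable N by apply: contra nabN => /(minnormal_abelian minN).
have [CN1|ntCN] := eqVneq 'C_G(N) 1; last first.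
  (* A minimal normal subgroup [M] inside the centraliser is transitive, so [N], which centralises
     [M], is semiregular and [#|N|] divides [#|P|]. *)
  have nC : G \subset 'N('C_G(N)) by rewrite normsI ?normG // norms_cent.
  have [M minM sMC] := minnormal_exists ntCN nC.
  have sMG : M \subset G by apply: subset_trans sMC (subsetIl _ _).
  have trM := primitive_minnormal_trans primG sMG minM.
  have cNM : N \subset 'C(M) by rewrite centsC (subset_trans sMC) ?subsetIr.
  constructor 3; exists N; split=> //.
  have dvdN : #|N| %| #|P|.
    apply: semiregular_dvdn => x; apply/trivgP/subsetP=> g /setIP[Ng /astab1P gx].
    by rewrite inE; apply/eqP; apply: trans_cent_fix trM _ gx; apply: (subsetP cNM).
  exact: (pi_of_dvd dvdN (ltnW P1)).
have [simN|nsimN] := boolP (simple N).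
  by constructor 2; rewrite /almost_simple_type (socle_unique_minnormal sNG minN CN1).
have [T minT sTN] := minnormal_exists ntN (normG N).
have [trC|ntrC] := boolP [transitive 'C_N(T), on [set: P] | 'P].
  constructor 3; exists N; split=> //.
  exact: (trans_cent_factor_primes primG sNG minN minT sTN trC).
constructor 4; exists (conj_factor G T), (@factor_class _ G N T).
exists #|[set orbit 'P 'C_N(T) x | x : P]|; split.
- exact: (conj_factor_gt1 minN minT sTN nsimN).
- exact: (factor_class_gt4 primG sNG minN nabN minT sTN ntrC).
- exact: (factor_class_invariant_grid primG sNG minN minT sTN ntrC).
Qed.

End PrimitiveStructure.

(** * Coprime action *)

(** Three distinct primes would give pairwise coprime parts, each at least [q + 1], whose product
    divides [v]. *)
Lemma size_primes_le2 v q :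
  0 < v -> v < q.+1 ^ 3 -> (forall r, r \in primes v -> q < v`_r) ->
  size (primes v) <= 2.
Proof.
move=> v0 vq qr; rewrite leqNgt; apply/negP=> s3.
have : uniq (primes v) := primes_uniq v.
case Dp: (primes v) s3 => [|r1 [|r2 [|r3 s]]] // _ /=.
rewrite !inE !negb_or => /and4P[/and3P[n12 n13 _] /andP[n23 _] _ _].
have mem r : r \in [:: r1; r2; r3] -> r \in primes v.
  by rewrite Dp !inE => /or3P[] /eqP->; rewrite eqxx ?orbT.
have q1 := qr r1 (mem _ _); have q2 := qr r2 (mem _ _); have q3 := qr r3 (mem _ _).
move: q1 q2 q3; rewrite !inE !eqxx ?orbT /= => /(_ isT) q1 /(_ isT) q2 /(_ isT) q3.
have cop (r r' : nat) : r != r' -> coprime v`_r v`_r'.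
  move=> rr; apply: (@pnat_coprime r); first exact: part_pnat.
  apply: sub_in_pnat (part_pnat r' v) => p _; rewrite !inE => /eqP->.
  by rewrite eq_sym.
have dvd : v`_r1 * v`_r2 * v`_r3 %| v.
  rewrite Gauss_dvd ?Gauss_dvd ?dvdn_part ?cop //.
  by rewrite coprimeMl !cop.
have := dvdn_leq v0 dvd; rewrite leqNgt => /negP; apply.
apply: leq_trans vq _; rewrite !expnS expn0 muln1 mulnA.
by rewrite !leq_mul.
Qed.

Section CoprimeAction.

Local Open Scope group_scope.

(** The [p]-part of the [H]-orbit is [#|S|] divided by the [p]-part of the order of the stabiliser
    in [H], and the order of the stabiliser in [S] divides the latter. *)
Lemma sylow_orbit_dvdn (gT : finGroupType) (rT : finType) (to : {action gT &-> rT})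
    (H S : {group gT}) p y :
  p.-Sylow(H) S -> #|orbit to H y|`_p %| #|orbit to S y|.
Proof.
move=> sylS; have oS := card_Hall sylS.
have pC : p.-group 'C_S[y | to] by apply: pgroupS (subsetIl _ _) (pHall_pgroup sylS).
have sC : #|'C_S[y | to]| %| #|'C_H[y | to]|`_p.
  by rewrite -(part_pnat_id pC) partn_dvd ?cardG_gt0 // cardSg ?setSI // (pHall_sub sylS).
have [t Dt] := dvdnP sC.
have : (#|orbit to S y| * #|'C_S[y | to]|)%N
     = (#|orbit to H y|`_p * (t * #|'C_S[y | to]|))%N.
  rewrite card_orbit_stab oS -(card_orbit_stab to H y) partnM ?cardG_gt0 ?Dt //.
  by apply/card_gt0P; exists y; apply: orbit_refl.
rewrite mulnA => /eqP; rewrite eqn_pmul2r ?cardG_gt0 // => /eqP->.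
exact: dvdn_mulr.
Qed.

(* Take a Sylow [p]-subgroup [S] of the stabiliser of [x], for [p] dividing [q].
   It acts coprimely on [N], so there is an [S]-invariant Sylow [r]-subgroup of
   [N] meeting the stabiliser of [x] in a Sylow subgroup; its orbit of [x] has
   size [#|P|`_r], and every [S]-orbit on it outside [x] is a multiple of [q`_p]. *)
Lemma part_congr1_of_subdegrees (P : finType) (G N : {group {perm P}}) (q r : nat) :
  N <| G -> [transitive N, on [set: P] | 'P] -> {subset \pi(#|N|) <= \pi(#|P|)} ->
  0 < q -> coprime q #|P| ->
  (forall x y : P, y != x -> q %| #|orbit 'P 'C_G[x | 'P] y|) ->
  q %| (#|P|`_r).-1.
Proof.
move=> /andP[sNG nNG] trN piN q0 coqP dvdq; apply/(dvdn_partP _ q0) => p pq.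
have [x _ _] := imsetP trN.
have p'N : p^'.-group N.
  apply/pgroupP=> s prs sN; rewrite inE; apply: contraTneq coqP => sp.
  have : s \in \pi(#|P|) by apply: piN; rewrite mem_primes prs cardG_gt0.
  rewrite mem_primes => /and3P[_ P0 sP].
  move: pq; rewrite -sp mem_primes => /and3P[_ _ sq].
  apply/negP=> /eqP gcd1; have : s %| 1 by rewrite -gcd1 dvdn_gcd sq.
  by rewrite dvdn1 => /eqP s1; rewrite s1 in prs.
pose Gx := 'C_G[x | 'P]%G; pose D := 'C_N[x | 'P]%G.
have [S sylS] := Sylow_exists p Gx.
have [sSGx pS _] := and3P sylS.
have sSG : S \subset G by apply: subset_trans sSGx (subsetIl _ _).
have fixS s : s \in S -> s x = x.
  by move/(subsetP sSGx)=> /setIP[_ /astab1P].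
have solS := pgroup_sol pS.
have nSN : S \subset 'N(N) by apply: subset_trans nNG.
have nSD : S \subset 'N(D).
  apply: normsI => //; apply: subset_trans (normG _).
  by apply: subset_trans sSGx (subsetIr _ _).
have coNS : coprime #|N| #|S| by rewrite coprime_sym (pnat_coprime pS).
have coDS : coprime #|D| #|S| by apply: coprimeSg coNS; apply: subsetIl.
have [R0 sylR0 nR0] := sol_coprime_Sylow_exists r solS nSD coDS.
have [sR0D rR0 _] := and3P sylR0.
have [R [sylR nSR sR0R]] := sol_coprime_Sylow_subset nSN coNS solS
  (subset_trans sR0D (subsetIl _ _)) rR0 nR0.
have [sRN rR _] := and3P sylR.
have oP : #|P| = #|orbit 'P N x| by rewrite (atransP trN) ?cardsT.
have oR : #|orbit 'P R x| = (#|P|`_r)%N.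
  (* The stabiliser of [x] in [R] is an [r]-subgroup of [D] that contains the Sylow subgroup
     [R0]. *)
  have DR0 : 'C_R[x | 'P] = R0.
    apply: (sub_pHall sylR0 (K := 'C_R[x | 'P]%G)); first exact: pgroupS (subsetIl _ _) rR.
      by rewrite subsetI sR0R (subset_trans sR0D) ?subsetIr.
    by rewrite setSI.
  have := card_orbit_stab 'P R x; rewrite DR0 (card_Hall sylR0) (card_Hall sylR).
  rewrite -(card_orbit_stab 'P N x) -oP partnM ?cardG_gt0 //; last first.
    by apply/card_gt0P; exists x.
  by move/eqP; rewrite eqn_pmul2r ?part_gt0 // => /eqP.
pose X := orbit 'P R x :\ x.
have -> : (#|P|`_r).-1 = #|X| by rewrite -oR (cardsD1 x) orbit_refl.
have actX : [acts S, on X | 'P].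
  apply/subsetP=> s Ss; rewrite !inE; apply/subsetP=> y; rewrite !inE.
  case/andP=> yx /orbitP[a Ra Dy].
  rewrite /= apermE -{1}(fixS _ Ss) (inj_eq perm_inj) yx /=.
  apply/orbitP; exists (a ^ s); first by rewrite memJ_norm // (subsetP nSR).
  rewrite -Dy /= !apermE -{1}(fixS _ Ss) -!permM conjgE !mulgA mulgV mul1g //.
rewrite -(acts_sum_card_orbit actX); apply: dvdn_sum => _ /imsetP[y Xy ->].
apply: dvdn_trans (sylow_orbit_dvdn 'P y sylS).
apply: partn_dvd; first by apply/card_gt0P; exists y; apply: orbit_refl.
by apply: dvdq; move: Xy; rewrite !inE => /andP[].
Qed.

End CoprimeAction.

(** * Divisibility of subdegrees and transitive normal subgroups of a flag-transitive group *)

Section CoprimeCase.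

Variables (P : finType) (blocks : {set {set P}}) (v k lam : nat).
Variable G : {group {perm P}}.
Hypothesis symD : is_symmetric_design blocks v k lam.
Hypothesis ltk : lam * (lam - 2) < k.
Hypothesis ftG : flag_transitive blocks G.

Let q := k %/ gcdn k lam.

(** Dividing the equation of [flag_count] by [gcdn k lam] leaves [q] coprime to the cofactor of
    [#|X|]. *)
Lemma invariant_set_dvdn x (X : {set P}) : x \notin X ->
  (forall (g : {perm P}) y, g \in G -> g x = x -> y \in X -> g y \in X) ->
  q %| #|X|.
Proof.
move=> xX invX; have [[_ _ _ /andP[k1 _] lam0] _] := symD.
have [B Bb xB] := exists_block symD x.
have E := flag_count symD ftG Bb xB xX invX.
have g0 : 0 < gcdn k lam by rewrite gcdn_gt0 lam0 orbT.
have coqa : coprime q (lam %/ gcdn k lam).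
  by rewrite /coprime /q -(eqn_pmul2r g0) muln_gcdl !divnK ?dvdn_gcdl ?dvdn_gcdr ?mul1n.
rewrite -(Gauss_dvdr _ coqa) -(dvdn_pmul2r g0) mulnAC.
by rewrite !divnK ?dvdn_gcdl ?dvdn_gcdr // E dvdn_mulr.
Qed.

Lemma subdegree_dvdn x y : y != x -> q %| #|orbit 'P 'C_G[x | 'P]%g y|.
Proof.
move=> yx; apply: (@invariant_set_dvdn x).
  apply/negP=> /orbitP[g /setIP[_ /astab1P gx] /= gy].
  by case/eqP: yx; apply: (@perm_inj _ g); rewrite -[g y]/(aperm y g) gy -{1}gx.
move=> g z Gg gx; rewrite -[g z]/('P%act z g) => zy.
apply: orbit_trans zy; apply: mem_orbit; rewrite inE Gg.
exact/astab1P.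
Qed.

Lemma lt_expn3 : v < q.+1 ^ 3.
Proof.
have [[_ _ _ /andP[k1 kv] lam0] _] := symD.
have kk := symmetric_design_eq symD.
have kq : k <= q * lam.
  rewrite /q; have := divnK (dvdn_gcdl k lam) => {1}<-.
  by rewrite leq_mul2l dvdn_leq ?orbT // dvdn_gcdr.
have vq : v.-1 <= q * k.-1.
  rewrite -(@leq_pmul2l lam) // -kk mulnA [lam * q]mulnC.
  by rewrite leq_mul2r kq orbT.
(* If [lam > q + 3], then [lam * (lam - 2) < k <= q * lam] gives the contradiction [lam - 2 < q].
   The slack [3] is affordable because [q * (q * q + 3 * q) + 1 < (q + 1) ^ 3]. *)
have kb : k <= q * q + 3 * q.
  have [le|gt] := leqP lam (q + 3).
    by apply: leq_trans kq _; rewrite -mulnDl mulnC leq_mul2r le orbT.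
  have : lam * (lam - 2) < q * lam by apply: leq_trans ltk kq.
  rewrite mulnC ltn_mul2r; lia.
have q0 : 0 < q by move: kq; case: (q) => [|//]; lia.
have : q * k.-1 <= q * (q * q + 3 * q) by rewrite leq_mul2l; lia.
by rewrite !expnS expn0; move: vq q0; move: (q) => Q; lia.
Qed.

Lemma normal_trans_solvable (N : {group {perm P}}) :
  (N <| G)%g -> [transitive N, on [set: P] | 'P] -> {subset \pi(#|N|) <= \pi(#|P|)} ->
  solvable N.
Proof.
move=> nsNG trN piN; have [[cardP _ _ /andP[k1 kv] lam0] _] := symD.
have q0 : 0 < q by rewrite divn_gt0 ?gcdn_gt0 ?lam0 ?orbT // dvdn_leq ?dvdn_gcdl //; lia.
have [x _] : exists x : P, true.
  have : 0 < #|P| by rewrite cardP; lia.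
  by case/card_gt0P=> x _; exists x.
have qv : q %| v.-1.
  rewrite -cardP -(cardsC1 x); apply: (@invariant_set_dvdn x).
    by rewrite !inE eqxx.
  by move=> g y Gg gx; rewrite !inE -{2}gx (inj_eq perm_inj).
have coqv : coprime q #|P|.
  by apply: coprime_dvdl qv _; rewrite cardP; case: (v) kv => [|u] // _; apply: coprimenS.
apply: Burnside_p_a_q_b; apply: (@leq_trans (size (primes v))).
  by apply: uniq_leq_size (primes_uniq _) _ => p pN; rewrite -cardP; apply: piN.
apply: (size_primes_le2 _ lt_expn3) => [|r]; first lia.
rewrite mem_primes => /and3P[prr v0 rv].
have := part_congr1_of_subdegrees r nsNG trN piN q0 coqv subdegree_dvdn.
rewrite cardP; have : 1 < v`_r by rewrite p_part_gt1 mem_primes prr v0.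
(* As [q] divides [u - 1] and [u > 1], it follows that [q < u]. *)
move: (v`_r) => u u1 /dvdn_leq; lia.
Qed.

End CoprimeCase.

(** * Product structures *)

(** Serves [grid_lt7], where [5] is the least value of [u + 1] and a factor [(u + 1) ^ 2] is split
    off from [(u + 1) ^ (m - 1)]. *)
Lemma expn5_ge_cube m : 7 <= m -> m ^ 3 + m ^ 2 <= 5 ^ (m - 3).
Proof.
elim: m => // m IHm; rewrite leq_eqVlt => /predU1P[<- //|m7].
have {}m7 : 7 <= m by [].
have := IHm m7; have -> : m.+1 - 3 = (m - 3).+1 by lia.
rewrite [5 ^ _.+1]expnS; move: (5 ^ (m - 3)) => X le.
have : 7 * 7 <= m * m by rewrite leq_mul.
have : 7 * (m * m) <= m * (m * m) by rewrite leq_mul2r m7 orbT.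
move: le; rewrite !expnS !expn0 !muln1; lia.
Qed.

(** * Arithmetic of designs on a grid *)

Section GridArith.

Variables (m u c k lam : nat).
Hypotheses (u4 : 4 <= u) (lam0 : 0 < lam) (k1 : 1 < k).
Hypothesis kk : k * k.-1 = lam * (u.+1 ^ m).-1.
Hypothesis lamc : lam * (m * u) = k * c.
Hypothesis ltk : lam * (lam - 2) < k.
Hypothesis m2 : 1 < m.

(** In the application [m] counts the coordinates, [u + 1] the values of each, and [c] the points of
    a block that differ from a given point of it in exactly one coordinate. With [v = (u + 1) ^ m],
    the sum [W] is [(v - 1) / u]. *)
Let W := \sum_(i < m) u.+1 ^ i.

Let c0 : 0 < c.
Proof. by case: c lamc => [|//]; rewrite muln0 => /eqP; rewrite !muln_eq0; lia. Qed.

Let mk : m * k.-1 = c * W.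
Proof.
have k0 : 0 < k by lia.
apply/eqP; rewrite -(eqn_pmul2l k0); apply/eqP.
rewrite mulnCA kk predn_exp -/W [u.+1.-1]/= [k * (c * W)]mulnA -lamc; lia.
Qed.

Lemma grid_dvd : lam * (m * m * u) = c * (m + c * W).
Proof.
have -> : lam * (m * m * u) = m * (k * c) by rewrite -lamc; lia.
rewrite -mk; have Dk : k = k.-1.+1 by lia.
by rewrite {1}Dk; move: (k.-1) => k'; lia.
Qed.

(** With [e = m * u] and [lam * e = k * c], the bound [lam * (lam - 2) < k] times [e ^ 2] becomes
    [c * (k * c - 2 * e) < e ^ 2]; multiplying by [m] and inserting [m * k = m + c * W] gives the
    claim. *)
Lemma grid_bound : c ^ 3 * W < m ^ 3 * u ^ 2 + 2 * c * m ^ 2 * u.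
Proof.
pose e := m * u; have e0 : 0 < e by rewrite muln_gt0; lia.
have lt1 : c * (k * c - 2 * e) < e * e.
  have k0 : 0 < k by lia.
  rewrite -(ltn_pmul2l k0) mulnA -lamc -/e -mulnBl mulnACA [k * _]mulnC.
  by rewrite mulnC ltn_pmul2l // muln_gt0 e0.
have lt2 : c * (k * c) < e * e + 2 * c * e.
  move: lt1; rewrite mulnBr; lia.
have lt3 : m * (c * (k * c)) < m * (e * e + 2 * c * e) by rewrite ltn_pmul2l //; lia.
have mk' : m * k = m + c * W.
  rewrite -mk; have Dk : k = k.-1.+1 by lia.
  by rewrite {1}Dk; move: (k.-1) => k'; lia.
 have : m * (c * (k * c)) = c * c * (m + c * W) by rewrite -mk'; lia.
move: lt3; rewrite /e !expnS !expn0; move: (W) => w; lia.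
Qed.

Lemma grid_exp_le : u.+1 ^ m.-1 <= W.
Proof.
by rewrite /W; case: (m) m2 => // n _; rewrite big_ord_recr /= leq_addl.
Qed.

Lemma grid_lt7 : m < 7.
Proof.
rewrite ltnNge; apply/negP=> m7; have := grid_bound; rewrite ltnNge => /negP; apply.
have h1 := grid_exp_le; have h2 := expn5_ge_cube m7.
have h3 : 5 ^ (m - 3) <= u.+1 ^ (m - 3) by rewrite leq_exp2r //; lia.
have h4 : u.+1 ^ 2 * (m ^ 3 + m ^ 2) <= W.
  apply: leq_trans h1; have -> : m.-1 = 2 + (m - 3) by lia.
  by rewrite expnD leq_mul2l (leq_trans h2 h3) orbT.
have c3 : c <= c ^ 3 by rewrite -{1}[c]expn1 leq_pexp2l.
have c31 : 1 <= c ^ 3 by rewrite expn_gt0 c0.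
apply: leq_trans (_ : c ^ 3 * (m ^ 3 * u ^ 2 + 2 * m ^ 2 * u) <= _).
  rewrite mulnDr leq_add ?leq_pmull //.
  by rewrite -[2 * c * _ * _]mulnA -[2 * c * _]mulnA mulnCA -[2 * _ * u]mulnA leq_mul2r c3 orbT.
rewrite leq_mul2l; apply/orP; right; apply: leq_trans h4.
rewrite mulnDr leq_add //; first by rewrite mulnC leq_mul2r leq_exp2r // leqnSn orbT.
rewrite mulnAC mulnC [X in _ <= X]mulnC leq_mul2l; apply/orP; right.
by rewrite !expnS expn0; lia.
Qed.

(** Since [W >= (u + 1) ^ 5], [grid_bound] leaves [c = 1] and [u] equal to [4] or [5], and both
    contradict [grid_dvd]. *)
Lemma grid_neq6 : m <> 6.
Proof.
move=> Dm; have D := grid_dvd; have B := grid_bound; have E := grid_exp_le.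
rewrite -/W Dm in E D B; move: B E D; rewrite /W Dm !big_ord_recr big_ord0 /=.
set V := 0 + _ + _ + _ + _ + _ + _ => B E D.
have B' : c ^ 3 * u.+1 ^ 5 < 216 * u.+1 ^ 2 + 72 * c * u.+1.
  have : c ^ 3 * u.+1 ^ 5 <= c ^ 3 * V by rewrite leq_mul2l E orbT.
  move: B; rewrite !expnS !expn0; lia.
have {}B' : c ^ 3 * u.+1 ^ 4 < 216 * u.+1 + 72 * c.
  have : u.+1 * (c ^ 3 * u.+1 ^ 4) < u.+1 * (216 * u.+1 + 72 * c).
    move: B'; rewrite !expnS !expn0; lia.
  by rewrite ltn_pmul2l.
have c1 : c = 1.
  apply/eqP; rewrite eqn_leq c0 andbT leqNgt; apply/negP=> c2.
  have h : 125 * 4 * (c * u.+1) <= c ^ 3 * u.+1 ^ 4.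
    have -> : c ^ 3 * u.+1 ^ 4 = u.+1 ^ 3 * c ^ 2 * (c * u.+1) by rewrite !expnS !expn0; lia.
    by rewrite leq_mul2r (@leq_mul (5 ^ 3) (2 ^ 2)) ?orbT // leq_exp2r.
  have h1 : 2 * u.+1 <= c * u.+1 by rewrite leq_mul2r c2 orbT.
  have h2 : c * 5 <= c * u.+1 by rewrite leq_mul2l; lia.
  lia.
move: B' D; rewrite /V c1 => B' D.
have u5 : u < 6.
  rewrite ltnNge; apply/negP=> u6.
  have h : 7 ^ 3 * u.+1 <= u.+1 ^ 4 by rewrite (expnS _ 3) mulnC leq_mul2l leq_exp2r // u6 orbT.
  move: B'; rewrite exp1n mul1n; lia.
move: D; clear -u4 u5.
have [->|->] : u = 4 \/ u = 5 by lia.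
  by lia.
by lia.
Qed.

Lemma grid_neq5 : m <> 5.
Proof.
move=> Dm; have D := grid_dvd; have B := grid_bound; have E := grid_exp_le.
rewrite -/W Dm in E D B; move: B E D; rewrite /W Dm !big_ord_recr big_ord0 /=.
set V := 0 + _ + _ + _ + _ + _ => B E D.
have B' : c ^ 3 * u.+1 ^ 4 < 125 * u.+1 ^ 2 + 50 * c * u.+1.
  have : c ^ 3 * u.+1 ^ 4 <= c ^ 3 * V by rewrite leq_mul2l E orbT.
  move: B; rewrite !expnS !expn0; lia.
have {}B' : c ^ 3 * u.+1 ^ 3 < 125 * u.+1 + 50 * c.
  have : u.+1 * (c ^ 3 * u.+1 ^ 3) < u.+1 * (125 * u.+1 + 50 * c).
    move: B'; rewrite !expnS !expn0; lia.
  by rewrite ltn_pmul2l.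
have c1 : c = 1.
  apply/eqP; rewrite eqn_leq c0 andbT leqNgt; apply/negP=> c2.
  have h : 25 * 4 * (c * u.+1) <= c ^ 3 * u.+1 ^ 3.
    have -> : c ^ 3 * u.+1 ^ 3 = u.+1 ^ 2 * c ^ 2 * (c * u.+1) by rewrite !expnS !expn0; lia.
    by rewrite leq_mul2r (@leq_mul (5 ^ 2) (2 ^ 2)) ?orbT // leq_exp2r.
  have h1 : 2 * u.+1 <= c * u.+1 by rewrite leq_mul2r c2 orbT.
  have h2 : c * 5 <= c * u.+1 by rewrite leq_mul2l; lia.
  lia.
move: B' D; rewrite /V c1 => B' D.
have u5 : u < 11.
  rewrite ltnNge; apply/negP=> u6.
  have h : 12 ^ 2 * u.+1 <= u.+1 ^ 3 by rewrite (expnS _ 2) mulnC leq_mul2l leq_exp2r // u6 orbT.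
  move: B'; rewrite exp1n mul1n; lia.
move: D; clear -u4 u5; move: u u4 u5.
by do 11?[case=> //]; lia.
Qed.

(** Here [c = 2] survives as well. As [W] is [4] modulo [u], [grid_dvd] read modulo [u] bounds [u]
    when [c = 1]; for [c = 2] the size bound does. *)
Lemma grid_neq4 : m <> 4.
Proof.
move=> Dm; have D := grid_dvd; have B := grid_bound; have E := grid_exp_le.
rewrite -/W Dm in E D B; move: B E D; rewrite /W Dm !big_ord_recr big_ord0 /=.
set V := 0 + _ + _ + _ + _ => B E D.
have B' : c ^ 3 * u.+1 ^ 3 < 64 * u.+1 ^ 2 + 32 * c * u.+1.
  have : c ^ 3 * u.+1 ^ 3 <= c ^ 3 * V by rewrite leq_mul2l E orbT.
  move: B; rewrite !expnS !expn0; lia.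
have {}B' : c ^ 3 * u.+1 ^ 2 < 64 * u.+1 + 32 * c.
  have : u.+1 * (c ^ 3 * u.+1 ^ 2) < u.+1 * (64 * u.+1 + 32 * c).
    move: B'; rewrite !expnS !expn0; lia.
  by rewrite ltn_pmul2l.
have c2 : c <= 2.
  rewrite leqNgt; apply/negP=> c3.
  have h : 5 * 9 * (c * u.+1) <= c ^ 3 * u.+1 ^ 2.
    have -> : c ^ 3 * u.+1 ^ 2 = u.+1 * c ^ 2 * (c * u.+1) by rewrite !expnS !expn0; lia.
    by rewrite leq_mul2r (@leq_mul 5 (3 ^ 2)) ?orbT // leq_exp2r.
  have h1 : 3 * u.+1 <= c * u.+1 by rewrite leq_mul2r c3 orbT.
  have h2 : c * 5 <= c * u.+1 by rewrite leq_mul2l; lia.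
  lia.
have u_dvd : u %| 4 * c * (c + 1).
  have : u %| 4 * c * (c + 1) + u * (c * c * (u ^ 2 + 4 * u + 6)).
    apply/dvdnP; exists (lam * 16); move: D; rewrite /V !expnS !expn0; lia.
  by rewrite dvdn_addl // dvdn_mulr.
have [cc|cc] : c = 1 \/ c = 2 by lia.
  move: D u_dvd; rewrite /V cc => D /dvdn_leq u8; have {}u8 : u <= 8 by apply: u8.
  move: D; clear -u4 u8; move: u u4 u8.
  by do 9?[case=> //]; lia.
have u5 : u < 8.
  rewrite ltnNge; apply/negP=> u8; move: B'; rewrite cc (expnS _ 1) expn1.
  have : 9 * u.+1 <= u.+1 * u.+1 by rewrite leq_mul2r.
  lia.
move: D; rewrite /V cc; clear -u4 u5; move: u u4 u5.
by do 8?[case=> //]; lia.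
Qed.

Lemma grid_neq3 : m <> 3.
Proof.
move=> Dm; have D := grid_dvd; have B := grid_bound.
rewrite -/W Dm in D B; move: B D; rewrite /W Dm !big_ord_recr big_ord0 /=.
set V := 0 + _ + _ + _ => B D.
have DV : V = u * u + 3 * u + 3 by rewrite /V !expnS !expn0; lia.
have B' : c ^ 3 * (u + 3) < 27 * u + 18 * c.
  have : u * (c ^ 3 * (u + 3)) < u * (27 * u + 18 * c).
    move: B; rewrite DV; move: (c ^ 3) => C; rewrite !expnS !expn0; lia.
  by rewrite ltn_pmul2l //; lia.
have c2 : c <= 2.
  rewrite leqNgt; apply/negP=> c3.
  have h : 3 ^ 2 * c <= c ^ 3 by rewrite (expnS _ 2) mulnC leq_mul2l leq_exp2r // c3 orbT.
  rewrite -[3 ^ 2]/9 in h.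
  have h1 : 9 * c * (u + 3) <= c ^ 3 * (u + 3) by rewrite leq_mul2r h orbT.
  have h2 : 3 * u <= c * u by rewrite leq_mul2r c3 orbT.
  lia.
have u_dvd : u %| 3 * c * (c + 1).
  have : u %| 3 * c * (c + 1) + u * (c * c * (u + 3)).
    apply/dvdnP; exists (lam * 9); move: D; rewrite DV; lia.
  by rewrite dvdn_addl // dvdn_mulr.
have [cc|cc] : c = 1 \/ c = 2 by lia.
  move: D u_dvd; rewrite DV cc => D /dvdn_leq u8; have {}u8 : u <= 6 by apply: u8.
  move: D; clear -u4 u8; move: u u4 u8.
  by do 7?[case=> //]; lia.
move: D u_dvd; rewrite DV cc => D /dvdn_leq u8; have {}u8 : u <= 18 by apply: u8.
move: D; clear -u4 u8; move: u u4 u8.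
by do 19?[case=> //]; lia.
Qed.

(** For [m = 2], [W = u + 2] and [u] divides [2 * c * (c + 1)]. With [grid_bound] this gives
    [c < 18] and [u <= 612], a finite range in which [c] and [u] determine [lam] and [k]. *)
Lemma grid_arith : m = 2 /\ (u, c, k) \in [:: (8, 3, 16); (10, 4, 25); (20, 5, 56)].
Proof.
have Dm : m = 2.
  move: grid_neq3 grid_neq4 grid_neq5 grid_neq6 m2 grid_lt7.
  by clear; lia.
split=> //; have D := grid_dvd; have B := grid_bound.
rewrite -/W Dm in D B; move: B D; rewrite /W Dm !big_ord_recr big_ord0 /=.
set V := 0 + _ + _ => B D.
have DV : V = u + 2 by rewrite /V !expnS !expn0; lia.
rewrite DV in B D.
have B' : c ^ 3 < 8 * u + 8 * c.
  have : u * c ^ 3 < u * (8 * u + 8 * c).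
    move: B; move: (c ^ 3) => C; rewrite !expnS !expn0; lia.
  by rewrite ltn_pmul2l //; lia.
have u_dvd : u %| 2 * c * (c + 1).
  have : u %| 2 * c * (c + 1) + u * (c * c).
    apply/dvdnP; exists (lam * 4); move: D; lia.
  by rewrite dvdn_addl // dvdn_mulr.
have u_le : u <= 2 * c * (c + 1) by apply: dvdn_leq u_dvd; rewrite !muln_gt0; lia.
have c18 : c < 18.
  rewrite ltnNge; apply/negP=> c18.
  have : 18 ^ 2 * c <= c ^ 3 by rewrite (expnS _ 2) mulnC leq_mul2l leq_exp2r // c18 orbT.
  rewrite -[18 ^ 2]/(18 * 18).
  have : 18 * (c * c) <= c ^ 3 by rewrite !expnS expn0 muln1 leq_mul2r c18 orbT.
  lia.
have [t Dt] := dvdnP u_dvd.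
have E1 : 4 * lam = c * c + t.
  have : u * (4 * lam) = u * (c * c + t) by move: D; lia.
  by move/eqP; rewrite eqn_pmul2l; [move/eqP|lia].
have E2 : 2 * k = 2 + c * (u + 2).
  have E3 : u * (4 * lam) = 2 * (k * c) by rewrite -lamc Dm; lia.
  move: E3; rewrite E1 mulnDr [u * t]mulnC -Dt => E3.
  have : c * (2 * k) = c * (2 + c * (u + 2)) by lia.
  by move/eqP; rewrite eqn_pmul2l // => /eqP.
(* Here [s] is [4 * lam] and [2 + c * (u + 2)] is [2 * k], so the final test is twice the bound on
   [k]. *)
pose ok c u := if u %| 2 * c * (c + 1) then
    let s := c * c + 2 * c * (c + 1) %/ u in
    if 4 %| s then let l := s %/ 4 in
      (2 * (l * (l - 2)) < 2 + c * (u + 2)) ==> ((u, c) \in [:: (8, 3); (10, 4); (20, 5)])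
    else true else true.
have all_ok : all (fun c => all (ok c) (iota 4 610)) (iota 1 17) by vm_compute.
have ci : c \in iota 1 17 by rewrite mem_iota; lia.
have ui : u \in iota 4 610.
  have cc : c * c <= 17 * 17 by apply: leq_mul; lia.
  by rewrite mem_iota u4 /=; move: cc u_le c18; clear; lia.
have := allP (allP all_ok _ ci) _ ui.
rewrite /ok u_dvd Dt mulnK; last lia.
clear all_ok ci ui; rewrite -E1.
rewrite (dvdn_mulr lam (dvdnn 4)).
rewrite (mulKn lam (isT : 0 < 4)).
rewrite -E2.
rewrite (ltn_pmul2l (isT : 0 < 2)).
rewrite ltk /=.
by rewrite !inE !xpair_eqE => /or3P[] /andP[/eqP Eu /eqP Ec]; move: E2; rewrite Eu Ec; lia.
Qed.

End GridArith.

(** * Lines and neighbours in a grid *)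

Section Grid.

Variables (P I : finType) (G : {group {perm P}}) (cl : I -> P -> {set P}) (w : nat).
Hypothesis gridG : invariant_grid G cl w.

Let cl_inj x y : (forall i, cl i x = cl i y) -> x = y.
Proof. by case: gridG => + _ _ _; apply. Qed.
Let cl_ex i x y : exists2 z, cl i z = cl i y & forall j, j != i -> cl j z = cl j x.
Proof. by case: gridG => _ + _ _; apply. Qed.
Let card_cl i : #|[set cl i x | x : P]| = w.
Proof. by case: gridG => _ _ + _; apply. Qed.

Lemma card_grid (x0 : P) : #|P| = w ^ #|I|.
Proof.
pose phi (y : P) : {ffun I -> {set P}} := [ffun i => cl i y].
have phi_inj : injective phi.
  by move=> x y /ffunP E; apply: cl_inj => i; have := E i; rewrite !ffunE.
pose F i := mem [set cl i x | x : P].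
have -> : w ^ #|I| = #|(family F : simpl_pred {ffun I -> {set P}})|.
  rewrite card_family foldrE big_map big_enum /= -prod_nat_const.
  by apply: eq_bigr => i _; rewrite -(card_cl i).
rewrite -(card_codom phi_inj); apply: eq_card => f; apply/codomP/familyP => [[y ->] i|fF].
  by rewrite ffunE; apply: (imset_f (cl i)).
(* A point with prescribed coordinates is built by correcting one coordinate at a time. *)
suff [y Dy] : exists y, forall i, i \in enum I -> cl i y = f i.
  by exists y; apply/ffunP=> i; rewrite ffunE Dy ?mem_enum.
elim: (enum I) => [|i s [y IHs]]; first by exists x0.
have /imsetP[u _ fi] := fF i.
have [z zi zj] := cl_ex i y u; exists z => j; rewrite inE.
have [->|ji] := eqVneq j i; first by rewrite zi fi.
by rewrite zj //=; apply: IHs.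
Qed.

Definition grid_line i x := [set y | [forall j, (j != i) ==> (cl j y == cl j x)]].

Lemma grid_lineP i x y : reflect (forall j, j != i -> cl j y = cl j x) (y \in grid_line i x).
Proof.
rewrite inE; apply: (iffP forallP) => H j; first by move=> ji; apply/eqP/(implyP (H j)).
by apply/implyP=> ji; rewrite (H j).
Qed.

Lemma grid_line_refl i x : x \in grid_line i x.
Proof. exact/grid_lineP. Qed.

Lemma card_grid_line i x : #|grid_line i x| = w.
Proof.
rewrite -(card_cl i) -(card_in_imset (f := cl i) (D := grid_line i x)).
  apply: eq_card => X; apply/imsetP/imsetP=> [[y _ ->]|[y _ ->]]; first by exists y.
  have [z zi zj] := cl_ex i x y; exists z; last by rewrite zi.
  exact/grid_lineP.
move=> y z /grid_lineP yx /grid_lineP zx E; apply: cl_inj => j.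
by have [->//|ji] := eqVneq j i; rewrite yx ?zx.
Qed.

(** The neighbours of [x] in the Hamming graph of the grid. *)
Definition grid_neighbours x := \bigcup_i (grid_line i x :\ x).

Lemma sum_grid_neighbours (A : {set P}) x :
  #|A :&: grid_neighbours x| = \sum_i #|A :&: (grid_line i x :\ x)|.
Proof.
have E (B : {set P}) : #|A :&: B| = \sum_(y in B) (y \in A).
  rewrite -sum1_card big_mkcond [RHS]big_mkcond /=; apply: eq_bigr => y _.
  by rewrite inE; case: (y \in A); case: (y \in B).
rewrite E partition_disjoint_bigcup /=; first by apply: eq_bigr => i _; rewrite E.
move=> i j ij; rewrite -setI_eq0; apply/eqP/setP=> y.
rewrite in_setI !in_setD1 in_set0; apply/negP=> /andP[/andP[yx yi] /andP[_ yj]].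
case/eqP: yx; apply: cl_inj => h; have [->|hi] := eqVneq h i.
  by move/grid_lineP: yj; apply.
by move/grid_lineP: yi; apply.
Qed.

Lemma card_grid_neighbours x : #|grid_neighbours x| = #|I| * w.-1.
Proof.
rewrite -[grid_neighbours x]setTI sum_grid_neighbours -sum_nat_const.
apply: eq_bigr => i _; rewrite setTI -(card_grid_line i x).
by rewrite (cardsD1 x (grid_line i x)) grid_line_refl.
Qed.

Lemma grid_neighbours_self x : x \notin grid_neighbours x.
Proof. by apply/bigcupP=> -[i _]; rewrite !inE eqxx. Qed.

Lemma grid_neighbours_inv x (g : {perm P}) y :
  g \in G -> g x = x -> y \in grid_neighbours x -> g y \in grid_neighbours x.
Proof.
move=> Gg gx /bigcupP[i _]; rewrite in_setD1 => /andP[yx /grid_lineP yi].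
case: gridG => _ _ _ /(_ g Gg)[s s_inj sE]; apply/bigcupP; exists (s i) => //.
rewrite in_setD1 -{1}gx (inj_eq perm_inj) yx /=; apply/grid_lineP=> j ji.
have [t _ sK] : bijective s by apply: injF_bij.
have tj : t j != i by apply: contraNneq ji => <-; rewrite sK.
by apply/eqP; rewrite -[j]sK -gx sE yi.
Qed.

Lemma grid_section_act (g : {perm P}) (C : {set P}) x : g \in G ->
  exists2 s : I -> I, injective s & forall i,
    #|[set y in g @: C | cl (s i) y == cl (s i) (g x)]| = #|[set y in C | cl i y == cl i x]|.
Proof.
move=> Gg; case: gridG => _ _ _ /(_ g Gg)[s s_inj sE]; exists s => // i.
rewrite -[RHS](card_imset _ (@perm_inj _ g)); apply: eq_card => y; rewrite in_set.
apply/andP/imsetP=> [[/imsetP[z Cz ->]]|[z]].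
  by rewrite sE => zx; exists z; rewrite // inE Cz.
by rewrite inE => /andP[Cz zx] ->; rewrite sE zx imset_f.
Qed.

End Grid.

(** * Fibre sizes of two coordinates on a set *)

Lemma dvdn_card_uniform_fibers (T U : finType) (f : T -> U) (X : {set T}) a :
  (forall y, y \in X -> #|[set z in X | f z == f y]| = a) -> a %| #|X|.
Proof.
move=> fib; rewrite -sum1_card (partition_big_imset f) /=.
apply: dvdn_sum => _ /imsetP[y Xy ->].
by rewrite sum1dep_card fib.
Qed.

Section TwoCoordinates.

(* In the applications [f] and [g] are the two coordinates on a block [B], and
   the fibre sizes through a point of [B] are [a] and [b] up to order. *)
Variables (T U : finType) (f g : T -> U) (B : {set T}) (a b : nat).

Definition fiber_size (h : T -> U) y := #|[set z in B | h z == h y]|.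

Hypothesis fibB : forall y, y \in B ->
  (fiber_size f y = a /\ fiber_size g y = b) \/
  (fiber_size f y = b /\ fiber_size g y = a).

Lemma fiber_size_eq h y z : h z = h y -> fiber_size h z = fiber_size h y.
Proof. by rewrite /fiber_size => ->. Qed.

(** The points whose [f]-fibre has size [a] form a union of such fibres; the remaining points of [B]
    form a union of [g]-fibres of size [a]. *)
Lemma fiber_size_dvdn : a %| #|B|.
Proof.
pose A := [set y in B | fiber_size f y == a].
rewrite -(cardsID A B) (setIidPr _); last by apply/subsetP=> y; rewrite inE => /andP[].
apply: dvdn_add.
  apply: (dvdn_card_uniform_fibers (f := f)) => y; rewrite inE => /andP[By /eqP fy].
  rewrite -[RHS]fy; apply: eq_card => z; rewrite !inE.
  by have [E|_] := eqVneq (f z) (f y); rewrite ?andbF // (fiber_size_eq E) fy eqxx !andbT.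
apply: (dvdn_card_uniform_fibers (f := g)) => y; rewrite !inE => /andP[+ By].
rewrite By /= => fy; have [[E _]|[fb ga]] := fibB By; first by rewrite E eqxx in fy.
rewrite -[RHS]ga; apply: eq_card => z; rewrite !inE.
have [E|_] := eqVneq (g z) (g y); rewrite ?andbF // !andbT.
case Bz: (z \in B); rewrite ?andbF //= andbT.
have [[fza gzb]|[-> _]] := fibB Bz; last by rewrite -fb fy.
by move: (fiber_size_eq E); rewrite gzb ga => ba; rewrite fb ba eqxx in fy.
Qed.

(** On an [f]-fibre of size [a] all [g]-fibres have size [b], and conversely, so every [f]-fibre
    contributes [a * b]. *)
Lemma sum_fiber_size : \sum_(y in B) fiber_size g y = a * b * #|f @: B|.
Proof.
rewrite (partition_big_imset f) /= mulnC -sum_nat_const.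
apply: eq_bigr => _ /imsetP[y By ->].
rewrite (eq_bigr (fun _ => fiber_size g y)).
  rewrite sum_nat_const.
  have -> : #|[pred z in B | f z == f y]| = fiber_size f y.
    by apply: eq_card => z; rewrite !inE.
  by have [[-> ->]|[-> ->]] := fibB By; rewrite // mulnC.
move=> z /andP[Bz /eqP E].
move: (fiber_size_eq E); have [[-> ->]|[-> ->]] := fibB Bz;
 have [[-> ->]|[-> ->]] := fibB By; by [].
Qed.

End TwoCoordinates.

(** * Exclusion of product structures *)

Section NoGrid.

Variables (P : finType) (blocks : {set {set P}}) (v k lam : nat).
Variable G : {group {perm P}}.
Hypothesis symD : is_symmetric_design blocks v k lam.
Hypothesis ltk : lam * (lam - 2) < k.
Hypothesis ftG : flag_transitive blocks G.

Lemma no_invariant_grid (I : finType) (cl : I -> P -> {set P}) (w : nat) :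
  1 < #|I| -> 4 < w -> ~ invariant_grid G cl w.
Proof.
move=> I1 w4 gridG; have [[cardP card_block _ /andP[k1 kv] lam0] _] := symD.
have [x0 _] : exists x : P, true.
  have : 0 < #|P| by rewrite cardP; lia.
  by case/card_gt0P=> x _; exists x.
have [B Bb x0B] := exists_block symD x0.
have flag_c x : x \in B -> lam * (#|I| * w.-1) = k * #|B :&: grid_neighbours cl x|.
  move=> xB; rewrite -(card_grid_neighbours gridG x).
  apply: (flag_count symD ftG Bb xB); first exact: grid_neighbours_self.
  by move=> g y; apply: (grid_neighbours_inv gridG).
pose c := #|B :&: grid_neighbours cl x0|.
have kk : k * k.-1 = lam * (w.-1.+1 ^ #|I|).-1.
  by rewrite prednK ?(symmetric_design_eq symD) -?(card_grid gridG x0) ?cardP //; lia.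
have u4 : 4 <= w.-1 by lia.
have [I2 params] := grid_arith u4 lam0 k1 kk (flag_c _ x0B) ltk I1.
have /card_gt1P[i [j [_ _ ij]]] := I1.
have onlyij h : h = i \/ h = j.
  have : h \in [set i; j].
    suff -> : [set i; j] = [set: I] by rewrite inE.
    by apply/eqP; rewrite eqEcard subsetT cardsT I2 cards2 ij.
  by rewrite !inE => /orP[] /eqP; [left | right].
pose f h x := fiber_size B (cl h) x.
(* With two coordinates, the line in direction [h] is the fibre of the other coordinate; [x] itself
   accounts for the predecessor. *)
have line_f h h' x : h != h' -> x \in B -> #|B :&: (grid_line cl h x :\ x)| = (f h' x).-1.
  move=> hh xB; rewrite /f /fiber_size [in RHS](cardsD1 x) in_set xB eqxx /=.
  apply: eq_card => y; rewrite !in_setI !in_setD1 !in_set.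
  rewrite andbCA; congr (_ && (_ && _)).
  apply/forallP/eqP => [H|E h'']; first by apply/eqP/(implyP (H h')); rewrite eq_sym.
  apply/implyP=> h''h; suff -> : h'' = h' by rewrite E.
  by case: (onlyij h) (onlyij h') (onlyij h'') hh h''h => -> [] -> [] ->; rewrite ?eqxx.
have f_gt0 h x : x \in B -> 0 < f h x.
  by move=> xB; apply/card_gt0P; exists x; rewrite inE xB /=.
have sum_f x : x \in B -> f i x + f j x = c + 2.
  move=> xB; have : #|B :&: grid_neighbours cl x| = c.
    apply/eqP; rewrite -(@eqn_pmul2l k); last by lia.
    by rewrite -(flag_c x xB) (flag_c x0 x0B).
  rewrite (sum_grid_neighbours gridG) (bigD1 i) //= (bigD1 j) 1?eq_sym //=.
  rewrite big_pred0 => [|h]; last by case: (onlyij h) => ->; rewrite eqxx ?andbF.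
  rewrite (line_f i j) // (line_f j i) 1?eq_sym //.
  by have := f_gt0 i x xB; have := f_gt0 j x xB; lia.
pose a := f i x0; pose b := f j x0.
(* Some element of [G] fixes [B] and moves [x0] to [y]; it either keeps or swaps the two
   coordinates. *)
have fib y : y \in B -> (f i y = a /\ f j y = b) \/ (f i y = b /\ f j y = a).
  move=> yB; have [g [Gg Dy DB]] := flag_transP ftG Bb x0B Bb yB.
  have [s s_inj sE] := grid_section_act gridG B x0 Gg.
  have si := sE i; have sj := sE j; rewrite -DB -Dy in si sj.
  have sij : s i != s j by rewrite (inj_eq s_inj).
  case: (onlyij (s i)) (onlyij (s j)) sij si sj => -> [] ->; rewrite ?eqxx // => _ si sj.
    by left.
  by right.
have fib' y : y \in B -> (f j y = b /\ f i y = a) \/ (f j y = a /\ f i y = b).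
  by case/fib=> -[-> ->]; [left | right].
have ak : a %| k by rewrite -(card_block B) //; apply: (fiber_size_dvdn fib).
have bk : b %| k by rewrite -(card_block B) //; apply: (fiber_size_dvdn fib').
have ab : a + b = c + 2 := sum_f _ x0B.
have a0 : 0 < a := f_gt0 i x0 x0B.
have b0 : 0 < b := f_gt0 j x0 x0B.
have im_le h : #|cl h @: B| <= w.
  case: (gridG) => _ _ /(_ h) <- _; apply/subset_leq_card/subsetP=> _ /imsetP[y _ ->].
  exact: imset_f.
(* Summing both fibre sizes over [B] gives [k * (a + b)], and by [sum_fiber_size] each of the two
   sums is [a * b] times at most [w]. *)
have le2w : k * (a + b) <= 2 * (w * (a * b)).
  have -> : k * (a + b) = \sum_(y in B) (f i y + f j y).
    by rewrite -(card_block B) // -sum_nat_const; apply: eq_bigr => y yB; rewrite ab sum_f.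
  rewrite big_split /= (sum_fiber_size fib) (sum_fiber_size fib') [b * a]mulnC.
  have := leq_mul (leqnn (a * b)) (im_le i); have := leq_mul (leqnn (a * b)) (im_le j).
  by move: (a * b) => ab'; clear; lia.
move: params ab ak bk a0 b0 le2w; rewrite -/c !inE !xpair_eqE.
clearbody a b c; clear -w4.
(* Divisibility of [k] by [a] and [b] leaves only the pair [1], [4] for [k = 16] and [1], [5] for
   [k = 25], both against [le2w], and no pair for [k = 56]. *)
move=> /or3P[] /andP[/andP[/eqP Ew /eqP ->] /eqP ->] ab.
- have -> : w = 9 by lia.
  have -> : b = 5 - a by lia.
  have : a < 6 by lia.
  by clear; do 6?[case: a => [|a] //].
- have -> : w = 11 by lia.
  have -> : b = 6 - a by lia.
  have : a < 7 by lia.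
  by clear; do 7?[case: a => [|a] //].
have -> : w = 21 by lia.
have -> : b = 7 - a by lia.
have : a < 8 by lia.
by clear; do 8?[case: a => [|a] //].
Qed.

End NoGrid.

(** * The primitive and imprimitive cases combined *)

Unset Implicit Arguments.

(* In lam * (lam - 2), truncated subtraction only matters for lam = 1, where
   both the integer and the truncated bound follow from 2 <= k. *)
Theorem mainTheorem1 (P : finType) (blocks : {set {set P}}) (v k lam : nat)
    (G : {group {perm P}}) :
  is_symmetric_design blocks v k lam ->
  (lam * (lam - 2) < k)%N ->
  is_automorphism_group blocks G ->
  flag_transitive blocks G ->
  (point_primitive G /\ (affine_type G \/ almost_simple_type G))
  \/
  (point_imprimitive G /\
   (v, k, lam) = (lam ^ 2 * (lam + 2), lam * (lam + 1), lam)%N /\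
   forall (Q : {set {set P}}) (c d : nat),
     imprimitivity_system G [set: P] 'P Q ->
     #|Q| = d ->
     (forall Delta, Delta \in Q -> #|Delta| = c) ->
     exists l : nat,
       (forall B Delta, B \in blocks -> Delta \in Q ->
          #|B :&: Delta| = 0%N \/ #|B :&: Delta| = l) /\
       ((c, d, l) = (lam ^ 2, lam + 2, lam)%N \/
        (c, d, l) = (lam + 2, lam ^ 2, 2)%N)).
Proof.
move=> symD ltk _ ftG; have [[cardP _ _ /andP[k1 kv] _] _] := symD.
have trG := flag_trans_points symD ftG.
have [primG|nprimG] := boolP [primitive G, on [set: P] | 'P].
  left; split=> //; have P1 : (1 < #|P|)%N by rewrite cardP; lia.
  have [||[N [nsNG trN piN /negP[]]]|[I [cl [w [I1 w4 gridG]]]]] := primitive_structure P1 primG.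
  - by left.
  - by right.
  - exact: (normal_trans_solvable symD ltk ftG nsNG trN piN).
  - by case: (no_invariant_grid symD ltk ftG I1 w4 gridG).
right; have [Q impQ] : exists Q, imprimitivity_system G [set: P] 'P Q.
  by apply/existsP; move: nprimG; rewrite /primitive trG /= negbK.
have [Dv Dk] := imprimitivity_system_vk symD ltk ftG impQ.
split; first by split=> //; exists Q.
split=> [|Q' c d impQ' cardQ' card_class]; first by rewrite -Dv -Dk.
by have [_ _] := imprimitive_parameters symD ltk ftG impQ' cardQ' card_class.
Qed.
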